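(* Let $a\ge 1$ and let $\vec p=(p_1,\dots,p_a)$ be a probability vector. Let $E_{n,a,\vec p}$ denote expectation with respect to the biased $a$-shuffle measure $P_{n,a;\vec p}$ on $S_n$, and let $N_i(\pi)$ be the number of $i$-cycles of $\pi\in S_n$. Then, as formal power series in $u,x_1,x_2,\dots$, $$\sum_{n=0}^{\infty} u^n\, E_{n,a,\vec p}\Big[\prod_{i\ge 1} x_i^{N_i}\Big] = \prod_{i=1}^{\infty}\ \prod_{\substack{r_1,\dots,r_a\ge 0\\ r_1+\cdots+r_a=i}} \left(\frac{1}{1-p_1^{r_1}\cdots p_a^{r_a}u^i x_i}\right)^{M(r_1,\dots,r_a)} .$$
   Context: Probability vector: real $p_i\ge 0$ with $\sum_{i=1}^a p_i=1$. The $n=0$ term on the left equals $1$. For integers $r_1,\dots,r_a\ge0$ with $m=r_1+\cdots+r_a\ge 1$, $$M(r_1,\dots,r_a)=\frac1m\sum_{d\mid m,r_1,\dots,r_a}\mu(d)\frac{(m/d)!}{(r_1/d)!\cdots(r_a/d)!},$$ the sum being over positive integers $d$ dividing all of $m,r_1,\dots,r_a$, with $\mu$ the Möbius function. Descents: $\pi\in S_n$ has a descent at position $i$ ($1\le i\le n-1$) if $\pi(i)>\pi(i+1)$; by convention every $\pi\in S_n$ also has a descent at position $n$. The descent set of $\pi$ is the set of positions at which it has a descent. The measure $P_{n,a;\vec p}$ on $S_n$ (biased riffle shuffle): first choose $(b_1,\dots,b_a)$, $b_i\ge 0$, $b_1+\cdots+b_a=n$, with probability $\binom{n}{b_1\cdots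 b_a}\prod_{i=1}^a p_i^{b_i}$; then choose uniformly one of the $\binom{n}{b_1\cdots b_a}$ permutations $\pi\in S_n$ such that the descent set of $\pi^{-1}$ is contained in $\{b_1,b_1+b_2,\dots,b_1+\cdots+b_a=n\}$. *)

(* Defs.v *)
From HB Require Import structures.
From mathcomp Require Import all_boot all_order all_algebra all_fingroup finmap.
From mathcomp Require Import boolp classical_sets functions cardinality fsbigop.
From mathcomp Require Import reals.
From mathcomp.multinomials Require Import monalg.

Set Implicit Arguments.
Unset Strict Implicit.
Unset Printing Implicit Defensive.

Import Order.TTheory GRing.Theory Num.Theory.

Local Open Scope ring_scope.

Local Notation "1" := (@mone _) : monom_scope.
Local Notation "x * y" := (mmul x y) : monom_scope.

(* {cmonom I} is the type of finitely supported exponent families, so that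
   formal power series in the (possibly infinitely many) variables indexed by I
   are arbitrary families of coefficients indexed by {cmonom I}. *)
Definition mfps (R : Type) (I : choiceType) : Type := {cmonom I} -> R.

Definition mcoef (R : Type) (I : choiceType) (f : mfps R I) (m : {cmonom I}) :
  R := f m.

Section FormalPowerSeries.
Variables (R : comNzRingType) (I : choiceType).
Implicit Types (f g h : mfps R I) (m : {cmonom I}).

HB.instance Definition _ := Choice.copy (mfps R I) ({cmonom I} -> R).
HB.instance Definition _ := GRing.Zmodule.copy (mfps R I) ({cmonom I} -> R).

Lemma mfpsP f g : (forall m, mcoef f m = mcoef g m) <-> f = g.
Proof. by split=> [fg|->//]; apply/funext. Qed.

Lemma mcoefD f g m : mcoef (f + g) m = mcoef f m + mcoef g m.
Proof. by []. Qed.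

Lemma mcoefN f m : mcoef (- f) m = - mcoef f m.
Proof. by []. Qed.

Lemma mcoef0 m : mcoef (0 : mfps R I) m = 0.
Proof. by []. Qed.

Definition mfactor m : set ({cmonom I} * {cmonom I}) :=
  [set p | (p.1 * p.2)%M = m].

Lemma finite_mfactor m : finite_set (mfactor m).
Proof.
pose T := {ffun finsupp m -> 'I_(mdeg m).+1}.
pose mk (d : T) : {cmonom I} := [cmonom (d i : nat) | i : finsupp m]%M.
pose pr (c : T * T) := (mk c.1, mk c.2).
apply: (@sub_finite_set _ _ (pr @` setT)); last first.
  exact/finite_image/finite_finset.
have ex m1 : (forall i, (m1 i <= m i)%N) -> exists d, mk d = m1.
  move=> le1; exists [ffun i => inord (m1 (val i))].
  apply/eqP/cmP => i; rewrite cmE fsfun_ffun.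
  case: insubP => [u _ uE|/=].
    rewrite /= ffunE inordK uE // ltnS; apply: leq_trans (le1 i) _.
    rewrite mdegE (big_fsetD1 i) /= ?leq_addr //.
    by rewrite -uE; exact: valP.
  rewrite -cmE_eq0 => /eqP mi0; have := le1 i.
  by rewrite mi0 leqn0 => /eqP.
move=> [m1 m2] /= m12.
have [|d1 d1E] := ex m1; first by move=> i; rewrite -m12 cmM leq_addr.
have [|d2 d2E] := ex m2; first by move=> i; rewrite -m12 cmM leq_addl.
by exists (d1, d2) => //; rewrite /pr /= d1E d2E.
Qed.

Definition mfps_one : mfps R I := fun m => (m == 1%M)%:R.

Definition mfps_mul f g : mfps R I :=
  fun m => \sum_(p \in mfactor m) mcoef f p.1 * mcoef g p.2.

Let F m := fset_set (mfactor m).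

Let memF m p : (p \in F m) = ((p.1 * p.2)%M == m).
Proof.
rewrite in_fset_set; last exact: finite_mfactor.
by apply/idP/eqP; [move/set_mem|move=> ?; exact: mem_set].
Qed.

Lemma mfps_mulE f g m :
  mfps_mul f g m = \sum_(p <- fset_set (mfactor m)) mcoef f p.1 * mcoef g p.2.
Proof. exact/fsbig_finite/finite_mfactor. Qed.

Fact mfps_mulC : commutative mfps_mul.
Proof.
move=> f g; apply/funext => m; rewrite !mfps_mulE -/(F m).
pose sw (p : {cmonom I} * {cmonom I}) := (p.2, p.1).
have swK : cancel sw sw by case.
rewrite (perm_big [seq sw p | p <- F m]) /=.
  by rewrite big_map; apply: eq_bigr => p _; rewrite mulrC.
apply: uniq_perm; rewrite ?(map_inj_uniq (can_inj swK)) ?fset_uniq // => p.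
by rewrite -[p in RHS]swK (mem_map (can_inj swK)) !memF /= mulmC.
Qed.

Fact mfps_mulA : associative mfps_mul.
Proof.
move=> f g h; apply/funext => m; rewrite !mfps_mulE -/(F m).
pose G (t : {cmonom I} * {cmonom I} * {cmonom I}) :=
  mcoef f t.1.1 * mcoef g t.1.2 * mcoef h t.2.
transitivity (\sum_(t <- [seq (p.1, q.1, q.2) | p <- F m, q <- F p.2]) G t).
  rewrite big_allpairs_dep; apply: eq_bigr => p _.
  rewrite [mcoef (mfps_mul g h) _]mfps_mulE big_distrr /=.
  by apply: eq_bigr => q _; rewrite mulrA.
transitivity (\sum_(t <- [seq (q.1, q.2, p.2) | p <- F m, q <- F p.1]) G t);
  last first.
  rewrite big_allpairs_dep; apply: eq_bigr => p _.
  by rewrite [mcoef (mfps_mul f g) _]mfps_mulE big_distrl.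
apply: perm_big; apply: uniq_perm.
- apply: allpairs_uniq_dep => [|p _|u v]; try exact: fset_uniq.
  move=> /allpairsPdep[p [q [_ + ->]]] /allpairsPdep[p' [q' [_ + ->]]] /=.
  rewrite !memF; case: p q p' q' => [p1 p2] [q1 q2] [p1' p2'] [q1' q2'] /=.
  by move=> /eqP <- /eqP <- [-> -> ->].
- apply: allpairs_uniq_dep => [|p _|u v]; try exact: fset_uniq.
  move=> /allpairsPdep[p [q [_ + ->]]] /allpairsPdep[p' [q' [_ + ->]]] /=.
  rewrite !memF; case: p q p' q' => [p1 p2] [q1 q2] [p1' p2'] [q1' q2'] /=.
  by move=> /eqP <- /eqP <- [-> -> ->].
move=> [[a b] c]; apply/allpairsPdep/allpairsPdep => -[[p1 p2] [[q1 q2]]].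
  rewrite !memF /= => -[/eqP pm /eqP qm [-> -> ->]].
  exists ((p1 * q1)%M, q2), (p1, q1); split; rewrite ?memF //=.
  by rewrite -mulmA qm pm.
rewrite !memF /= => -[/eqP pm /eqP qm [-> -> ->]].
exists (q1, (q2 * p2)%M), (q2, p2); split; rewrite ?memF //=.
by rewrite mulmA qm pm.
Qed.

Fact mfps_mul1 : left_id mfps_one mfps_mul.
Proof.
move=> f; apply/funext => m; rewrite mfps_mulE -/(F m).
rewrite (big_fsetD1 (1%M, m)) ?memF ?mul1m //= big1_fset ?addr0.
  by rewrite /mcoef /mfps_one eqxx mul1r.
move=> [p1 p2]; rewrite in_fsetD1 memF /= => /andP[neq /eqP pm] _.
rewrite /mcoef /mfps_one; case: eqVneq => [p1E|]; rewrite ?mul0r //.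
by move: neq; rewrite -pm p1E mul1m eqxx.
Qed.

Fact mfps_mulDl : left_distributive mfps_mul +%R.
Proof.
move=> f g h; apply/funext => m; rewrite -[RHS]/(mfps_mul f h m + mfps_mul g h m).
by rewrite !mfps_mulE -big_split; apply: eq_bigr => p _; rewrite mcoefD mulrDl.
Qed.

Fact mfps_oner_neq0 : mfps_one != 0.
Proof.
apply/eqP => /mfpsP/(_ 1%M)/eqP; rewrite mcoef0 /mcoef /mfps_one eqxx.
by rewrite oner_eq0.
Qed.

HB.instance Definition _ := GRing.Zmodule_isComNzRing.Build (mfps R I)
  mfps_mulA mfps_mulC mfps_mul1 mfps_mulDl mfps_oner_neq0.

Definition mfps_scale (c : R) f : mfps R I := fun m => c * mcoef f m.

Fact mfps_scaleA a b f :
  mfps_scale a (mfps_scale b f) = mfps_scale (a * b) f.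
Proof. by apply/funext => m; exact: mulrA. Qed.

Fact mfps_scale1 : left_id 1 mfps_scale.
Proof. by move=> f; apply/funext => m; exact: mul1r. Qed.

Fact mfps_scaleDr : right_distributive mfps_scale +%R.
Proof. by move=> a f g; apply/funext => m; exact: mulrDr. Qed.

Fact mfps_scaleDl f : {morph mfps_scale^~ f : a b / a + b}.
Proof. by move=> a b; apply/funext => m; exact: mulrDl. Qed.

HB.instance Definition _ := GRing.Zmodule_isLmodule.Build R (mfps R I)
  mfps_scaleA mfps_scale1 mfps_scaleDr mfps_scaleDl.

Lemma mcoefZ c f m : mcoef (c *: f) m = c * mcoef f m.
Proof. by []. Qed.

Lemma mcoef1 m : mcoef (1 : mfps R I) m = (m == 1%M)%:R.
Proof. by []. Qed.

Lemma mcoefM f g m :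
  mcoef (f * g) m = \sum_(p \in mfactor m) mcoef f p.1 * mcoef g p.2.
Proof. by []. Qed.

Fact mfps_scaleAl (c : R) f g : c *: (f * g) = c *: f * g.
Proof.
apply/mfpsP => m; rewrite mcoefZ [in LHS]/mcoef [in RHS]/mcoef.
rewrite [(f * g) m]mfps_mulE [RHS]mfps_mulE big_distrr /=.
by apply: eq_bigr => p _; rewrite mcoefZ mulrA.
Qed.

HB.instance Definition _ := GRing.Lmodule_isLalgebra.Build R (mfps R I)
  mfps_scaleAl.
HB.instance Definition _ := GRing.Lalgebra_isComAlgebra.Build R (mfps R I).

(* Inverses are the two-sided inverses of the ring; a series without one is its
   own inverse, following the convention of unitRingType. *)
Definition mfps_unit : pred (mfps R I) := fun f => `[< exists g, g * f = 1 >].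

Definition mfps_inv f : mfps R I :=
  match pselect (exists g, g * f = 1) with
  | left ex => projT1 (cid ex)
  | right _ => f
  end.

Fact mfps_mulVr : {in mfps_unit, left_inverse 1 mfps_inv *%R}.
Proof.
move=> f /asboolP fU; rewrite /mfps_inv; case: pselect => // ex.
exact: (projT2 (cid ex)).
Qed.

Fact mfps_unitP f g : g * f = 1 -> mfps_unit f.
Proof. by move=> gf; apply/asboolP; exists g. Qed.

Fact mfps_inv_out : {in [predC mfps_unit], mfps_inv =1 id}.
Proof.
by move=> f; rewrite inE => /asboolP fU; rewrite /mfps_inv; case: pselect.
Qed.

HB.instance Definition _ := GRing.ComNzRing_hasMulInverse.Build (mfps R I)
  mfps_mulVr mfps_unitP mfps_inv_out.

Definition mfpsX (i : I) : mfps R I := fun m => (m == ucm i)%:R.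

(* Convergence of formal power series: every coefficient is eventually
   constant. *)
Definition mfps_cvg (s : nat -> mfps R I) f :=
  forall m, exists N, forall n, (N <= n)%N -> mcoef (s n) m = mcoef f m.

End FormalPowerSeries.

Section RiffleShuffle.

(* The quotient is exact; it is taken in a field of characteristic 0. *)
Definition multinomial (F : fieldType) (a n : nat) (b : 'I_a -> nat) : F :=
  n`!%:R / \prod_(j < a) (b j)`!%:R.

Definition moebius (n : nat) : int :=
  if all (fun q => ~~ (q ^ 2 %| n)%N) (primes n) then (-1) ^+ size (primes n)
  else 0.

Definition necklaceM (a : nat) (r : 'I_a -> nat) : rat :=
  let m := (\sum_(j < a) r j)%N in
  m%:R^-1 *
  \sum_(1 <= d < m.+1 | (d %| m)%N && [forall j, (d %| r j)%N])
     (moebius d)%:~R * multinomial rat (m %/ d) (fun j => (r j %/ d)%N).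

(* Positions are numbered from 1: position i of s carries the value
   s (Ordinal (i - 1 < n)).  Position n is a descent by convention. *)
Definition descent_set (n : nat) (s : 'S_n) : {set 'I_n.+1} :=
  [set i : 'I_n.+1 | (i == n :> nat) ||
    [exists j : 'I_n, exists k : 'I_n,
      [&& j.+1 == i :> nat, k == i :> nat & (s k < s j)%N]]].

Definition partial_sums (a n : nat) (b : 'I_a -> nat) : {set 'I_n.+1} :=
  [set i : 'I_n.+1 |
    [exists j : 'I_a, (i == \sum_(l < a | l <= j) b l :> nat)%N]].

Definition shuffles (a n : nat) (b : 'I_a -> nat) : {set 'S_n} :=
  [set s | descent_set s^-1%g \subset partial_sums n b].

Definition riffle_prob (R : fieldType) (a n : nat) (p : 'I_a -> R) (s : 'S_n) :
    R :=
  \sum_(b : {ffun 'I_a -> 'I_n.+1} | (\sum_(j < a) b j)%N == n)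
     (multinomial R n (fun j => b j) * \prod_(j < a) p j ^+ b j) *
     (if s \in shuffles n (fun j => b j)
      then #|shuffles n (fun j => b j)|%:R^-1 else 0).

Definition riffle_expect (R : fieldType) (a n : nat) (p : 'I_a -> R)
    (V : lmodType R) (f : 'S_n -> V) : V :=
  \sum_(s : 'S_n) riffle_prob p s *: f s.

Definition ncycles (n i : nat) (s : 'S_n) : nat :=
  #|[set C in porbits s | #|C| == i]|.

End RiffleShuffle.

(* The variables u, x_1, x_2, ... are indexed by nat, u being the variable of
   index 0. *)
Definition ser_u (R : comNzRingType) : mfps R nat := mfpsX R 0%N.
Definition ser_x (R : comNzRingType) (i : nat) : mfps R nat := mfpsX R i.

(* Main.v *)
From HB Require Import structures.
Require Import Defs.
From mathcomp Require Import all_boot all_order all_algebra all_fingroup reals.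
From mathcomp Require Import finmap.
From mathcomp.multinomials Require Import monalg.

(* Gessel's bijection.  Choosing the cut sizes b first and a shuffle s with
   Des(s^-1) in the partial sums of b amounts to choosing a nondecreasing word F
   together with t = s^-1 increasing on the fibres of F (a "standard pair").
   Attach to a position k the periodic word F(k) F(t k) F(t^2 k) ...; these
   words are nondecreasing in k, and t is recovered from them as the
   standardization of k |-> (shift of the word of k).  Hence standard pairs of
   size n correspond to shift-invariant multisets of n periodic words, that is,
   to multisets of primitive necklaces of total length n, the cycles of t
   being the necklaces.  To stay finite, periodic words of period at most K are
   represented by words of length K!, on which the shift acts by rotation: its
   orbits of size at most K are the primitive necklaces, and M(r) counts those
   of content r by Moebius inversion. *)

Set Implicit Arguments.
Unset Strict Implicit.
Unset Printing Implicit Defensive.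

Import Order.TTheory GRing.Theory Num.Theory.
Local Open Scope ring_scope.

(** * Standardization and sorting *)

Lemma card_ord_ltn n k : (k <= n)%N -> #|[pred i : 'I_n | (i < k)%N]| = k.
Proof.
move=> kn; rewrite -sum1_card (eq_bigl (fun i : 'I_n => (i < k)%N)) //.
by rewrite (big_ord_narrow kn) sum1_card card_ord.
Qed.

(** If [D k] holds then all of [0..k] lies in [D], so [D] has more than [k] elements; otherwise [D]
    lies strictly below [k]. *)
Lemma ord_downset n (D : pred 'I_n) :
    (forall k l : 'I_n, (k <= l)%N -> D l -> D k) ->
  forall k : 'I_n, D k = (k < #|D|)%N.
Proof.
move=> dD k; apply/idP/idP => [Dk|].
  rewrite -[k.+1](@card_ord_ltn n) //.
  by apply/subset_leq_card/fintype.subsetP => i; rewrite inE ltnS => /dD; apply.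
apply: contraLR => Dk; rewrite -leqNgt.
rewrite -[X in (_ <= X)%N](card_ord_ltn (ltnW (ltn_ord k))).
apply/subset_leq_card/fintype.subsetP => i Di; rewrite inE.
by rewrite ltnNge; apply: contra Dk => leki; apply: dD leki Di.
Qed.

(** The witness is the rank function, counting the elements strictly below [k]. It is strictly
    monotone for [r], and totality then makes it injective. *)
Lemma perm_of_order n (r : rel 'I_n) :
    irreflexive r -> transitive r -> (forall k l, k != l -> r k l || r l k) ->
  {s : 'S_n | forall k l, (s k < s l)%N = r k l}.
Proof.
move=> rxx rtr rtot.
have ltf k : (#|[pred l | r l k]| < n)%N.
  rewrite -[X in (_ < X)%N]card_ord; apply: proper_card.
  by rewrite properE subset_predT /=; apply/subsetPn; exists k; rewrite ?inE ?rxx.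
pose f k := Ordinal (ltf k).
have f_lt k l : r k l -> (f k < f l)%N.
  move=> rkl; apply: proper_card; rewrite properE; apply/andP; split.
    by apply/fintype.subsetP => i; rewrite !inE => rik; apply: rtr rik rkl.
  by apply/subsetPn; exists k; rewrite !inE ?rkl ?rxx.
have f_inj : injective f.
  move=> k l fkl; apply/eqP/negP => /negP /rtot /orP[] /f_lt;
  by rewrite fkl ltnn.
exists (perm f_inj) => k l; rewrite !permE; apply/idP/idP => [|/f_lt//].
apply: contraLR => nr; rewrite -leqNgt; have [->//|/rtot] := eqVneq k l.
by rewrite (negbTE nr) /= => /f_lt /ltnW.
Qed.

(** A value [s k] is its own rank, the number of [l] with [s l < s k], so the comparisons determine
    [s]. *)
Lemma eq_perm_lt n (s t : 'S_n) :
  (forall k l, (s k < s l)%N = (t k < t l)%N) -> s = t.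
Proof.
have rankE (u : 'S_n) k : u k = #|[pred l | (u l < u k)%N]| :> nat.
  rewrite -[RHS](card_image (@perm_inj _ u)).
  rewrite (eq_card (B := [pred i : 'I_n | (i < u k)%N])); last first.
    move=> i; rewrite inE; apply/imageP/idP => [[l + ->]//|ik].
    by exists (u^-1 i)%g; rewrite ?inE permKV.
  by rewrite card_ord_ltn // ltnW.
move=> st; apply/permP => k; apply: ord_inj; rewrite (rankE s) (rankE t).
by apply: eq_card => l; rewrite !inE st.
Qed.

Section Sorting.
Context {d : Order.disp_t} {X : orderType d} {n : nat}.
Implicit Types (z W : 'I_n -> X) (s t : 'S_n).

Definition nondecr W := forall k l : 'I_n, (k <= l)%N -> (W k <= W l)%O.

(* [s] ranks the positions by letter, equal letters from left to right. *)
Definition standardizes z s :=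
  forall k l : 'I_n, (k < l)%N -> (s k < s l)%N = (z k <= z l)%O.

Lemma standardizes_ex z : {s | standardizes z s}.
Proof.
(* Lexicographic order on (letter, position); its ranking is the standardization. *)
pose r : rel 'I_n := fun k l => (z k < z l)%O || (z k == z l) && (k < l)%N.
have [|||s sP] := @perm_of_order n r.
- by move=> k; rewrite /r ltxx ltnn andbF.
- move=> l k m; rewrite /r => /orP[kl|/andP[/eqP-> kl]] /orP[lm|/andP[/eqP lm lm']].
  + by rewrite (lt_trans kl lm).
  + by rewrite -lm kl.
  + by rewrite lm.
  + by rewrite lm eqxx (ltn_trans kl lm') orbT.
- move=> k l; rewrite /r; case: (ltgtP (z k) (z l)) => //= _.
  by rewrite -neq_ltn.
exists s => k l kl; rewrite sP /r kl andbT orbC.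
by rewrite le_eqVlt.
Qed.

Lemma standardizes_uniq z s t : standardizes z s -> standardizes z t -> s = t.
Proof.
move=> sP tP; apply: eq_perm_lt => k l.
case: (ltngtP k l) => [kl|lk|/val_inj ->]; last by rewrite !ltnn.
  by rewrite sP ?tP.
have nkl : k != l by rewrite neq_ltn lk orbT.
have lt_ge (u : 'S_n) : (u k < u l)%N = ~~ (u l < u k)%N.
  rewrite -leqNgt ltn_neqAle; case: eqVneq => [/val_inj/perm_inj/eqP|] //.
  by rewrite (negbTE nkl).
by rewrite !lt_ge sP ?tP.
Qed.

Lemma standardizes_nondecr z s : standardizes z s -> nondecr (fun k => z (s^-1 k)%g).
Proof.
move=> sP k l; rewrite leq_eqVlt => /orP[/eqP/val_inj-> //|].
rewrite -{1}(permKV s k) -{1}(permKV s l).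
case: (ltngtP (s^-1 k)%g (s^-1 l)%g) => [h|h|/val_inj->]; rewrite ?lexx //.
  by rewrite sP.
move=> lt; have := sP _ _ h; rewrite ltnNge ltnW //= => /esym/negbT.
by rewrite -ltNge => /ltW.
Qed.

(** The two lists of values are sorted and are permutations of each other, hence equal. *)
Lemma nondecr_uniq W W' : nondecr W -> nondecr W' ->
    (forall x, #|[pred k | W k == x]| = #|[pred k | W' k == x]|) ->
  W =1 W'.
Proof.
have srt V : nondecr V -> sorted <=%O (map V (enum 'I_n)).
  move=> Vn; rewrite sorted_map; have: sorted ltn (map val (enum 'I_n)).
    by rewrite val_enum_ord iota_ltn_sorted.
  by rewrite sorted_map; apply: sub_sorted => k l /= /ltnW /Vn.
have cnt V x : count_mem x (map V (enum 'I_n)) = #|[pred k | V k == x]|.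
  rewrite count_map cardE size_filter enumT /=.
  by apply: eq_count => k.
move=> /srt Ws /srt W's eqc k.
have : map W (enum 'I_n) = map W' (enum 'I_n).
  by apply: le_sorted_eq => //; apply/allP => x _ /=; rewrite !cnt eqc.
by move/eq_in_map; apply; rewrite mem_enum.
Qed.

End Sorting.

Lemma nondecr_ex {d} {X : finOrderType d} n (m : X -> nat) :
    (\sum_x m x)%N = n ->
  exists2 W : 'I_n -> X, nondecr W & forall x, #|[pred k | W k == x]| = m x.
Proof.
move=> mn; pose s := sort <=%O (flatten [seq nseq (m x) x | x <- enum X]).
have cnt x : count_mem x s = m x.
  rewrite (seq.permP (permEl (perm_sort _ _))) count_flatten -map_comp.
  rewrite sumnE big_map big_enum /= (bigD1 x) //= count_nseq /= eqxx mul1n.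
  by rewrite big1 ?addn0 // => y yx; rewrite count_nseq /= (negbTE yx).
have szs : size s = n.
  rewrite size_sort size_flatten /shape -map_comp sumnE big_map big_enum /= -mn.
  by apply: eq_bigr => x _; rewrite /= size_nseq.
have tup : size s == n by apply/eqP.
exists (tnth (Tuple tup)) => [k l kl|x].
  (* [X] may be empty, so the default element for [nth] is taken from the position [k]. *)
  have [x0 _] : exists x0 : X, true by exists (tnth (Tuple tup) k).
  rewrite !(tnth_nth x0) /=; apply: (sorted_leq_nth le_trans lexx x0) => //.
  - exact: sort_le_sorted.
  - by rewrite inE szs.
  - by rewrite inE szs.
rewrite -cnt -[s]/(tval (Tuple tup)) -[in RHS](map_tnth_enum (Tuple tup)).
rewrite count_map cardE size_filter enumT.
by apply: eq_count.
Qed.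

(** * Words of given content *)

Definition has_content a n (b : 'I_a -> nat) (w : n.-tuple 'I_a) :=
  [forall j, count_mem j w == b j].

(** Induction on the first letter: after multiplication by the factorials, the words beginning with
    [j] contribute [b j * n!], and the [b j] add up to [n + 1]. *)
Lemma card_words a n (b : 'I_a -> nat) : (\sum_j b j)%N = n ->
  (#|has_content (n := n) b| * \prod_j (b j)`! = n`!)%N.
Proof.
elim: n b => [|n IHn] b bn.
  have b0 j : b j = 0%N by apply/eqP; move/eqP: bn; rewrite sum_nat_eq0 => /forallP/(_ j).
  rewrite big1 ?muln1 => [|j _]; last by rewrite b0.
  rewrite fact0 (eq_card (B := predT)) ?card_tuple ?expn0 // => w.
  by rewrite [LHS]unfold_in [RHS]unfold_in /=; apply/forallP => j; rewrite b0 (tuple0 w).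
rewrite -sum1_card (reindex (fun p : 'I_a * n.-tuple 'I_a => [tuple of p.1 :: p.2])) /=; last first.
  exists (fun w : n.+1.-tuple 'I_a => (thead w, [tuple of behead w])).
    by move=> [j v] _ /=; rewrite theadE; congr (_, _); apply: val_inj.
  by move=> w _; rewrite /= -tuple_eta.
rewrite -(pair_big_dep xpredT (fun (j : 'I_a) (v : n.-tuple 'I_a) => has_content b [tuple of j :: v])
   (fun _ _ => 1%N)) /= big_distrl /=.
transitivity ((\sum_j b j) * n`!)%N; last by rewrite bn.
rewrite big_distrl /=.
apply: eq_bigr => j _; case bj: (b j) => [|m].
  rewrite big1 // => v /forallP/(_ j); rewrite /= eqxx bj.
  by rewrite add1n.
(* Content of the tail once the leading [j] is removed. *)
pose b' l := (b l - (l == j))%N.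
have b'E l : b l = ((j == l) + b' l)%N.
  by rewrite eq_sym /b'; case: eqP => [->|_]; rewrite ?bj ?subn0 // subnKC.
have /IHn <- : (\sum_l b' l = n)%N.
  apply/eqP; rewrite -(eqn_add2l 1) [(1 + n)%N]add1n -bn; apply/eqP.
  rewrite (eq_bigr _ (fun l _ => b'E l)) big_split /=; congr (_ + _)%N.
  by rewrite (bigD1 j) //= eqxx big1 // => l; rewrite eq_sym => /negbTE->.
rewrite sum1_card mulnCA; congr (_ * _)%N.
  apply: eq_card => v; apply: eq_forallb => l /=.
  by rewrite b'E eqn_add2l.
rewrite -bj (bigD1 j) //= [in RHS](bigD1 j) //= {1}/b' eqxx bj subn1 factS -mulnA.
congr (_ * (_ * _))%N; apply: eq_bigr => l lj.
by rewrite (b'E l) eq_sym (negbTE lj).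
Qed.

Lemma card_words_multinomial (F : numFieldType) a n (b : 'I_a -> nat) :
  (\sum_j b j)%N = n -> #|has_content (n := n) b|%:R = multinomial F n b.
Proof.
move=> bn; rewrite /multinomial -(card_words bn) natrM -natr_prod mulfK //.
by rewrite pnatr_eq0 -lt0n prodn_gt0 // => j; rewrite fact_gt0.
Qed.

(** * Riffle shuffles and standard pairs *)

Section Shuffles.
Variables a n : nat.
Implicit Types (F : 'I_n -> 'I_a) (s : 'S_n).

Definition content F j := #|[pred k | F k == j]|.

Definition stdpair s F :=
  [forall k : 'I_n, forall l : 'I_n, (k < l)%N ==>
    ((F k < F l)%N || (F k == F l) && (s k < s l)%N)].

Lemma stdpairP s F :
  reflect (forall k l : 'I_n, (k < l)%N ->
             (F k < F l)%N \/ F k = F l /\ (s k < s l)%N)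
          (stdpair s F).
Proof.
apply: (iffP 'forall_forallP) => H k l; last first.
  by apply/implyP => /H [->//|[-> ->]]; rewrite eqxx orbT.
by move=> kl; have /implyP/(_ kl)/orP[|/andP[/eqP]] := H k l; [left|right].
Qed.

Lemma stdpair_nondecr s F : stdpair s F -> nondecr F.
Proof.
move=> /stdpairP H k l; rewrite leq_eqVlt => /orP[/eqP/val_inj->|/H]; first exact: lexx.
by case=> [/ltnW|[-> _]]; rewrite leEord.
Qed.

Lemma sum_content F : (\sum_j content F j)%N = n.
Proof.
rewrite -[RHS]card_ord -sum1_card (partition_big F xpredT) //=.
by apply: eq_bigr => j _; rewrite sum1_card; apply: eq_card => k; rewrite !inE.
Qed.

Lemma content_perm F s : content (fun k => F (s k)) =1 content F.
Proof.
move=> j; rewrite /content -(card_image (@perm_inj _ s)); apply: eq_card => k.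
apply/imageP/eqP => [[i /eqP/= <- ->] //|kj].
by exists (s^-1 k)%g; rewrite ?permKV // inE /= permKV kj.
Qed.

Lemma count_mktuple F j : count_mem j (mktuple F) = content F j.
Proof.
by rewrite /content /= count_map cardE size_filter enumT; apply: eq_count.
Qed.

(** The positions with letter at most [j] are down-closed, hence an initial segment, whose length is
    the partial sum of the contents. *)
Lemma nondecr_leE F (b : 'I_a -> nat) : nondecr F -> content F =1 b ->
  forall (k : 'I_n) (j : 'I_a),
    (F k <= j)%N = (k < \sum_(l < a | (l <= j)%N) b l)%N.
Proof.
move=> Fn Fb k j.
rewrite -[LHS]/([pred i | (F i <= j)%N] k) ord_downset; last first.
  by move=> i l /Fn; rewrite leEord /=; exact: leq_trans.
congr (_ < _)%N; rewrite -sum1_card /= (partition_big F (fun l : 'I_a => (l <= j)%N)) //=.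
apply: eq_bigr => l lj; rewrite -Fb sum1_card; apply: eq_card => i.
by rewrite !unfold_in /=; case: (eqVneq (F i) l) => [->|]; rewrite ?andbF // lj.
Qed.

(** The partial sums strictly between 0 and [n] are the places where [F] jumps. Confining descents
    to them means that the inverse of [s] increases wherever [F] is constant. *)
Lemma mem_shuffles s F (b : 'I_a -> nat) : nondecr F -> content F =1 b ->
  (0 < a)%N -> (s \in shuffles n b) = stdpair s^-1%g F.
Proof.
move=> Fn Fb a_gt0; have FE := nondecr_leE Fn Fb.
have bn : (\sum_j b j)%N = n by rewrite -(sum_content F); apply: eq_bigr.
rewrite inE; move: (s^-1%g) => {}s; apply/fintype.subsetP/stdpairP => [H k l|H i].
  have step (i j : 'I_n) : i.+1 = j -> (F i < F j)%N \/ F i = F j /\ (s i < s j)%N.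
    move=> ij; have : (F i <= F j)%O by apply: Fn; rewrite -ij.
    rewrite leEord leq_eqVlt => /orP[/eqP/val_inj Fij|]; [right|by left].
    split=> //; rewrite ltn_neqAle; apply/andP; split.
      by apply/eqP => /val_inj/perm_inj ijE; move: ij; rewrite ijE => /eqP; rewrite eqn_leq ltnn.
    rewrite leqNgt; apply/negP => sji.
    (* A descent from index [i] to [j = i + 1], counted from 0, sits at position [j] counted from 1.
       Were [j] a partial sum, [F] would jump between [i] and [j]. *)
    have := H (inord j); rewrite !inE (inordK (ltnW (ltn_ord j) : (j < n.+1)%N)) => /(_ _)/existsP[|m /eqP jE].
      apply/orP; right; apply/existsP; exists i; apply/existsP; exists j.
      by rewrite sji eqxx ij eqxx.
    have := FE i m; have := FE j m; rewrite -jE ltnn -ij leqnn => Fj Fi.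
    by move: Fj; rewrite -Fij Fi.
  (* Consecutive positions suffice: the (letter, value) pairs are compared lexicographically, which
     is transitive. *)
  elim: (nat_of_ord l) {-2}l (erefl (nat_of_ord l)) => [|m IHm] {}l lm; first by rewrite lm.
  rewrite lm ltnS leq_eqVlt => /orP[/eqP km|km]; first by apply: step; rewrite km.
  have mn : (m < n)%N by rewrite -ltnS -lm ltnS ltnW.
  have {IHm} := IHm (Ordinal mn) erefl km.
  have := step (Ordinal mn) l (esym lm).
  move=> [lt1|[e1 lt1]] [lt2|[e2 lt2]].
  - by left; apply: ltn_trans lt2 lt1.
  - by left; rewrite e2.
  - by left; rewrite -e1.
  - by right; split; [rewrite e2|apply: ltn_trans lt2 lt1].
rewrite !inE => /orP[/eqP iE|/existsP[j /existsP[k /and3P[/eqP jE /eqP kE skj]]]].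
  (* The conventional descent at [n] is the full sum, attained at the last index [a - 1]. *)
  have aa : (a.-1 < a)%N by rewrite prednK.
  apply/existsP; exists (Ordinal aa); rewrite /= iE -[X in X == _]bn; apply/eqP.
  by apply: eq_bigl => l; rewrite -ltnS prednK // ltn_ord.
have jk : (j < k)%N by rewrite kE -jE.
(* A genuine descent forces [F j < F k]; since [k = j + 1], the partial sum up to the letter [F j]
   is exactly [k]. *)
have [lt|[_ /ltn_trans/(_ skj)]] := H _ _ jk; last by rewrite ltnn.
apply/existsP; exists (F j); rewrite eqn_leq -{1}jE -FE leqnn /= leqNgt -kE -FE.
by rewrite -ltnNge.
Qed.

(** With [F] the nondecreasing word of content [b], a shuffle [s] corresponds to the word [F (s k)];
    [s] is recovered as the standardization of that word. *)
Lemma card_shuffles (b : 'I_a -> nat) : (0 < a)%N -> (\sum_j b j)%N = n ->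
  #|shuffles n b| = #|has_content (n := n) b|.
Proof.
move=> a_gt0 bn; have [F Fn Fb] := nondecr_ex bn.
have shP s := @mem_shuffles s F b Fn Fb a_gt0.
pose w s := mktuple (fun k => F (s k)).
have wP s : s \in shuffles n b -> standardizes (fun k => F (s k)) s.
  rewrite shP => /stdpairP H k l kl.
  case: (ltngtP (s k) (s l)) => [lt|lt|/val_inj/perm_inj kl']; last by rewrite kl' ltnn in kl.
    by rewrite (Fn _ _ (ltnW lt)).
  have := H _ _ lt; rewrite !permK; case=> [lt'|[_ /ltn_trans/(_ kl)]]; last by rewrite ltnn.
  by rewrite leEord leqNgt lt'.
rewrite -(card_in_imset (f := w)) => [|s t sb tb /(congr1 (@tnth _ _))].
  apply: eq_card => v; apply/imsetP/forallP => [[s sb ->] j|vP].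
    by rewrite count_mktuple content_perm; apply/eqP; exact: Fb.
  have [s sP] := standardizes_ex (tnth v).
  have Fv : F =1 (fun k => tnth v (s^-1 k)%g).
    apply: nondecr_uniq => //; first exact: standardizes_nondecr.
    move=> j; rewrite Fb -(eqP (vP j)) [RHS](content_perm (tnth v) s^-1 j).
    by rewrite -count_mktuple /= map_tnth_enum.
  exists s; last by apply: eq_from_tnth => k; rewrite tnth_mktuple Fv permK.
  rewrite shP; apply/stdpairP => k l kl; have := Fn _ _ (ltnW kl).
  rewrite leEord leq_eqVlt => /orP[/eqP/val_inj Fkl|]; [right|by left].
  split=> //; case: (ltngtP (s^-1 k)%g (s^-1 l)%g) => // [lt|/val_inj/perm_inj klE].
    have := sP _ _ lt; rewrite -!Fv !permKV Fkl lexx => lk.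
    by move: kl; rewrite ltnNge ltnW.
  by rewrite klE ltnn in kl.
move=> st; apply: (@standardizes_uniq _ _ _ (fun k => F (s k))); first exact: wP.
have: (fun k => F (s k)) =1 (fun k => F (t k)).
  by move=> k; have := congr1 (fun f => f k) st; rewrite !tnth_mktuple.
move=> e k l kl; rewrite !e; exact: wP.
Qed.

(** The cut sizes [b] and the nondecreasing words [F] determine each other through the content. The
    multinomial weight of [b] cancels against the uniform choice among its shuffles. *)
Lemma riffle_prob_stdpair (R : numFieldType) (p : 'I_a -> R) s : (0 < a)%N ->
  riffle_prob p s =
    \sum_(F : {ffun 'I_n -> 'I_a} | stdpair s^-1%g F) \prod_k p (F k).
Proof.
move=> a_gt0.
have cn F j : (content F j < n.+1)%N.
  by rewrite ltnS -[X in (_ <= X)%N]card_ord max_card.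
pose c (F : {ffun 'I_n -> 'I_a}) : {ffun 'I_a -> 'I_n.+1} := [ffun j => Ordinal (cn F j)].
rewrite (partition_big c (fun b => \sum_(j < a) b j == n)%N) /=; last first.
  move=> F _; rewrite -[X in _ == X](sum_content F); apply/eqP/eq_bigr => j _.
  by rewrite ffunE.
apply: eq_bigr => b /eqP bn; have [G Gn Gb] := nondecr_ex bn.
have shP : (s \in shuffles n (fun j => b j)) = stdpair s^-1%g [ffun k => G k].
  rewrite (mem_shuffles s Gn Gb a_gt0); apply/stdpairP/stdpairP => H k l kl;
  by have := H k l kl; rewrite ?ffunE.
have uniqG (F : {ffun 'I_n -> 'I_a}) : stdpair s^-1%g F -> c F = b -> F = [ffun k => G k].
  move=> /stdpair_nondecr Fn cF; apply/ffunP => k; rewrite ffunE.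
  by apply: nondecr_uniq k => // j; rewrite Gb -cF ffunE.
case: ifP => [sb|sNb]; last first.
  rewrite mulr0 big1 // => F /andP[sF /eqP cF].
  by move: sNb; rewrite shP -(uniqG F) // sF.
(* The multinomial is the number of shuffles, nonzero because [s] is one of them. *)
rewrite -(card_words_multinomial _ bn) -card_shuffles // mulrAC mulfV ?mul1r; last first.
  by rewrite pnatr_eq0 -lt0n; apply/card_gt0P; exists s.
rewrite (big_pred1 [ffun k => G k]).
  rewrite (eq_bigr (fun k => p (G k))) => [|k _]; last by rewrite ffunE.
  rewrite (partition_big G xpredT) //=; apply: eq_bigr => j _.
  rewrite -Gb -prodr_const; apply: eq_big => [k|k /eqP <-] //.
move=> F; apply/andP/eqP => [[sF /eqP cF]|->]; first exact: uniqG.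
rewrite -shP; split=> //; apply/eqP/ffunP => j; apply: val_inj.
by rewrite ffunE /= -Gb; apply: eq_card => k; rewrite !inE ffunE.
Qed.
End Shuffles.

(** * Periodic words *)

Section Words.
Variables a T : nat.

Definition word : Type := T.+1.-tuplelexi 'I_a.
HB.instance Definition _ := Order.FinTotal.copy word (T.+1.-tuplelexi 'I_a).

Implicit Types (x y : word) (t : nat).

Definition rotw x : word := [tuple of rot 1 x].

Lemma rotw_inj : injective rotw.
Proof. by move=> x y /(congr1 val)/rot_inj xy; apply: val_inj. Qed.

Definition rho : {perm word} := perm rotw_inj.

(** The letter at any index [t] of the infinite periodic word that [x] represents; no bound on [t]
    is imposed. *)
Definition letter x t : 'I_a := thead (iter t rho x).

Lemma letter_iter x s t : letter (iter s rho x) t = letter x (t + s).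
Proof. by rewrite /letter iterD. Qed.

Lemma val_iter_rho x t : (t <= T.+1)%N -> val (iter t rho x) = rot t (val x).
Proof.
elim: t => [|t IHt] tT; first by rewrite rot0.
by rewrite /= permE /= IHt ?(ltnW tT) // -rotD ?size_tuple // add1n.
Qed.

Lemma iter_rho x : iter T.+1 rho x = x.
Proof.
by apply: val_inj; rewrite val_iter_rho // rot_oversize ?size_tuple.
Qed.

Lemma letterE x (i : 'I_T.+1) : letter x i = tnth x i.
Proof.
rewrite /letter /thead !(tnth_nth (thead x)) val_iter_rho; last exact: ltnW.
by rewrite /rot nth_cat size_drop size_tuple subn_gt0 ltn_ord nth_drop addn0.
Qed.

Lemma letter_ext x y : (forall t, letter x t = letter y t) -> x = y.
Proof. by move=> xy; apply: eq_from_tnth => i; rewrite -!letterE xy. Qed.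

Lemma letter_mod x t : letter x (t %% T.+1) = letter x t.
Proof.
rewrite {2}(divn_eq t T.+1); elim: (t %/ T.+1)%N => [//|q ->].
by rewrite mulSn -addnA [(T.+1 + _)%N]addnC -(letter_iter x T.+1) iter_rho.
Qed.

Definition word_of (f : nat -> 'I_a) : word := [tuple f i | i < T.+1].

Lemma letter_word_of f : (forall t, f (t + T.+1)%N = f t) -> letter (word_of f) =1 f.
Proof.
move=> fT t; have tT : (t %% T.+1 < T.+1)%N by rewrite ltn_pmod.
have fq q r : f (q * T.+1 + r)%N = f r.
  by elim: q => // q <-; rewrite mulSn -addnA addnC fT.
by rewrite -letter_mod (letterE _ (Ordinal tT)) tnth_mktuple /= [in RHS](divn_eq t T.+1) fq.
Qed.

(** Lexicographic order on tuples agrees with that on infinite periodic words: a first difference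
    beyond a full period would force [x = y]. *)
Lemma ltwP x y :
  reflect (exists2 t, forall i, (i < t)%N -> letter x i = letter y i &
                      (letter x t < letter y t)%N)
          (x < y)%O.
Proof.
apply: (iffP (@ltxi_tuplePlt _ _ _ _ x y)) => -[t eqt ltt].
  exists t; last by rewrite !letterE.
  move=> i it; have iT : (i < T.+1)%N by apply: ltn_trans it _.
  by rewrite -[i]/(val (Ordinal iT)) !letterE eqt.
have [tT|Tt] := ltnP t T.+1.
  exists (Ordinal tT) => [i it|]; first by rewrite -!letterE eqt.
  by rewrite -!letterE.
have: x = y.
  apply: letter_ext => i; rewrite -letter_mod -[RHS]letter_mod eqt //.
  by apply: leq_trans Tt; rewrite ltn_pmod.
by move=> xy; rewrite xy ltnn in ltt.
Qed.

Lemma lew_head x y : (x <= y)%O -> (letter x 0 <= letter y 0)%N.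
Proof.
rewrite le_eqVlt => /orP[/eqP->//|/ltwP[[|t] eqt ltt]]; first exact: ltnW.
by rewrite eqt.
Qed.

(** Rotation moves the equal first letters to the end, so the first difference just moves one place
    to the left. *)
Lemma lew_tail x y : (x <= y)%O -> letter x 0 = letter y 0 -> (rho x <= rho y)%O.
Proof.
rewrite le_eqVlt => /orP[/eqP->//|/ltwP[[|t] eqt ltt]] xy0.
  by rewrite xy0 ltnn in ltt.
apply/ltW/ltwP; exists t => [i it|].
  by rewrite !(letter_iter _ 1) addn1 eqt.
by rewrite !(letter_iter _ 1) addn1.
Qed.

(** * Reading periodic words off a standard pair *)

Section Reading.
Variable n : nat.
Hypothesis n_le : forall i, (0 < i <= n)%N -> (i %| T.+1)%N.
Implicit Types (s : 'S_n) (F : 'I_n -> 'I_a).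

(** Each cycle has length at most [n], which divides [T.+1]; this lets words of length [T.+1] carry
    the readings of all positions. *)
Lemma iter_perm_id s k : iter T.+1 s k = k.
Proof.
have /n_le/dvdnP[q ->] : (0 < #|porbit s k| <= n)%N.
  by rewrite lt0n card_porbit_neq0 -[X in (_ <= X)%N]card_ord max_card.
by elim: q => // q IHq; rewrite mulSn iterD IHq iter_porbit.
Qed.

Definition read s F k : word := word_of (fun t => F (iter t s k)).

Lemma letter_read s F k t : letter (read s F k) t = F (iter t s k).
Proof. by rewrite letter_word_of // => {}t; rewrite iterD iter_perm_id. Qed.

Lemma rho_read s F k : rho (read s F k) = read s F (s k).
Proof.
by apply: letter_ext => t; rewrite (letter_iter _ 1) !letter_read addn1 iterSr.
Qed.

(** While the letters read from [k < l] agree, [s] keeps the two positions in order. At the first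
    difference the nondecreasing [F] then puts the smaller letter on the side of [k]. *)
Lemma read_nondecr s F : stdpair s F -> nondecr (read s F).
Proof.
move=> sF k l; rewrite leq_eqVlt => /orP[/eqP/val_inj->//|kl].
rewrite leNgt; apply/ltwP => -[t eqt].
have itlt i : (i <= t)%N -> (iter i s k < iter i s l)%N.
  elim: i => [//|i IHi] it; have /(stdpairP _ _ sF)[|[]//] := IHi (ltnW it).
  by have := eqt _ it; rewrite !letter_read => ->; rewrite ltnn.
rewrite !letter_read ltnNge.
by have /ltnW/(stdpair_nondecr sF) := itlt t (leqnn t); rewrite leEord => ->.
Qed.

Lemma read_lt s F (k l : 'I_n) : stdpair s F ->
  (k < l)%N -> read s F k = read s F l -> (s k < s l)%N.
Proof.
move=> sF /(stdpairP _ _ sF)[|[]//] FF' /(congr1 (letter^~ 0%N)).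
by rewrite !letter_read /= => FE; rewrite FE ltnn in FF'.
Qed.

(** Distinct words at [s k] and [s l] order these positions by monotonicity of [read]. If they are
    equal, so are the words at [k] and [l], and [s] preserves the order of such positions. *)
Lemma read_standardizes s F : stdpair s F -> standardizes (fun k => rho (read s F k)) s.
Proof.
move=> sF k l kl; rewrite !rho_read.
case: (ltgtP (read s F (s k)) (read s F (s l))) => [lt|lt|/eqP eqr].
- rewrite ltnNge; apply/negP => /(read_nondecr sF).
  by rewrite leNgt lt.
- apply/negbTE; rewrite -leqNgt leqNgt; apply/negP => /ltnW/(read_nondecr sF).
  by rewrite leNgt lt.
- apply: (read_lt sF) => //; apply/(@perm_inj _ rho)/eqP; by rewrite !rho_read.
Qed.

(** The multiset of words fixes [read] by sortedness; then [s] is a standardization and [F] is given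
    by first letters. *)
Lemma read_uniq s s' F F' : stdpair s F -> stdpair s' F' ->
    (forall x, #|[pred k | read s F k == x]| = #|[pred k | read s' F' k == x]|) ->
  s = s' /\ F =1 F'.
Proof.
move=> sF sF' /(nondecr_uniq (read_nondecr sF) (read_nondecr sF')) eqr; split.
  apply: standardizes_uniq (read_standardizes sF) _ => k l kl.
  by rewrite !eqr; apply: read_standardizes.
by move=> k; have /(congr1 (letter^~ 0%N)) := eqr k; rewrite !letter_read.
Qed.

(** Sort the multiset into [W] and let [s] standardize the rotated words. Invariance under rotation
    makes these a rearrangement of [W], whence [W (s k) = rho (W k)], and [F] takes first
    letters. *)
Lemma read_ex (m : word -> nat) : (forall x, m (rho x) = m x) ->
    (\sum_x m x)%N = n ->
  exists s (F : {ffun 'I_n -> 'I_a}),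
    stdpair s F /\ forall x, #|[pred k | read s F k == x]| = m x.
Proof.
move=> m_rho mn; have [W Wn Wm] := nondecr_ex mn.
have [s sP] := standardizes_ex (fun k => rho (W k)).
have Ws k : W (s k) = rho (W k).
  rewrite -[in RHS](permK s k); move: (s k) => {}k.
  move: k; change (W =1 (fun k => rho (W (s^-1 k)%g))).
  apply: nondecr_uniq => //; first exact: (standardizes_nondecr sP).
  move=> x; rewrite Wm -(permKV rho x) m_rho -Wm -(card_image (@perm_inj _ s)).
  apply: eq_card => k; rewrite inE (inj_eq perm_inj); apply/imageP/eqP.
    by move=> [i /eqP/= <- ->]; rewrite permK.
  by move=> Wk; exists (s^-1 k)%g; rewrite ?permKV // inE; apply/eqP.
pose F := [ffun k => letter (W k) 0]; exists s, F.
have rW k : read s F k = W k.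
  apply: letter_ext => t; rewrite letter_read ffunE.
  have -> : W (iter t s k) = iter t rho (W k) by elim: t => //= t <-; rewrite Ws.
  by rewrite letter_iter.
split=> [|x]; last by rewrite -Wm; apply: eq_card => k; rewrite !inE rW.
apply/stdpairP => k l kl; rewrite !ffunE; have /lew_head := Wn _ _ (ltnW kl).
rewrite leq_eqVlt => /orP[/eqP/val_inj eF|]; [right|by left].
by split=> //; rewrite sP //; apply: lew_tail => //; apply: Wn; apply: ltnW.
Qed.

End Reading.
End Words.

(** * Orbits of a permutation *)

Section Porbits.
Variables (X : finType) (s : {perm X}).

Lemma porbit_in C x : C \in porbits s -> (porbit s x == C) = (x \in C).
Proof. by move=> /imsetP[y _ ->]; rewrite eq_porbit_mem. Qed.

Lemma card_porbits_gt0 C : C \in porbits s -> (0 < #|C|)%N.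
Proof. by case/imsetP => x _ ->; rewrite lt0n card_porbit_neq0. Qed.

Lemma big_porbits (R : Type) (idx : R) (op : Monoid.com_law idx) (G : X -> R) :
  \big[op/idx]_x G x = \big[op/idx]_(C in porbits s) \big[op/idx]_(x in C) G x.
Proof.
rewrite (partition_big (porbit s) [in porbits s]) /= => [|x _].
  by apply: eq_bigr => C Cs; apply: eq_bigl => x; rewrite porbit_in.
exact: imset_f.
Qed.

Lemma sum_card_porbits : (\sum_(C in porbits s) #|C|)%N = #|X|.
Proof.
rewrite -[RHS]sum1_card (big_porbits) /=.
by apply: eq_bigr => C _; rewrite sum1_card.
Qed.

Lemma big_porbit (R : Type) (idx : R) (op : Monoid.com_law idx) (G : X -> R) x :
  \big[op/idx]_(y in porbit s x) G y =
    \big[op/idx]_(t < #|porbit s x|) G (iter t s x).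
Proof.
rewrite (eq_bigl [in traject s x #|porbit s x|]); last exact: porbit_traject.
rewrite -big_uniq ?uniq_traject_porbit //=.
move: #|_| => d; elim: d x => [|d IHd] x; first by rewrite big_nil big_ord0.
rewrite big_ord_recl big_cons IHd; congr (op _ _).
by apply: eq_bigr => t _; rewrite -iterSr.
Qed.

Lemma iter_porbit_mul x q r : iter (q * #|porbit s x| + r) s x = iter r s x.
Proof.
by elim: q r => // q IHq r; rewrite mulSnr -addnA IHq addnC iterD iter_porbit.
Qed.

(** The remainder of [e] modulo the orbit size indexes a repetition of [x] in a duplicate-free
    trajectory, so it is 0. *)
Lemma iter_eq_dvdn x e : (iter e s x == x) = (#|porbit s x| %| e)%N.
Proof.
have d_gt0 : (0 < #|porbit s x|)%N by rewrite lt0n card_porbit_neq0.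
apply/eqP/dvdnP => [|[q ->]]; last by rewrite -[(q * _)%N]addn0 iter_porbit_mul.
rewrite {1}(divn_eq e #|porbit s x|) iter_porbit_mul => ex.
exists (e %/ #|porbit s x|)%N; rewrite {1}(divn_eq e #|porbit s x|).
have rd : (e %% #|porbit s x| < #|porbit s x|)%N by rewrite ltn_mod.
have := nth_uniq x _ _ (uniq_traject_porbit s x).
move=> /(_ (e %% #|porbit s x|)%N 0%N); rewrite size_traject => /(_ rd d_gt0).
by rewrite !nth_traject // ex eqxx => /esym/eqP ->; rewrite addn0.
Qed.

End Porbits.

Lemma prod_by_card (R : comNzRingType) (X : finType) (A : {set {set X}}) K
    (G : {set X} -> R) : (forall C, C \in A -> 0 < #|C|)%N ->
  \prod_(1 <= i < K.+1) \prod_(C in A | #|C| == i) G C =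
    \prod_(C in A | (#|C| <= K)%N) G C.
Proof.
move=> A_gt0; rewrite (exchange_big_dep [in A]) /=; last by move=> i C _ /andP[].
rewrite [RHS]big_mkcondr; apply: eq_bigr => C CA /=.
rewrite (eq_bigl (fun i => i == #|C|)) => [|i]; last by rewrite CA eq_sym.
case: ifP => [CK|CK]; last first.
  rewrite big_nat_cond big1 // => i /andP[/andP[_ iK] /eqP iC].
  by move: CK; rewrite -iC -ltnS iK.
rewrite -big_filter (perm_big [:: #|C|]) ?big_seq1 //; apply: uniq_perm => // [|i].
  by rewrite filter_uniq ?iota_uniq.
rewrite mem_filter mem_index_iota inE; case: eqP => //= ->.
by rewrite A_gt0 // ltnS CK.
Qed.

(** * Moebius inversion *)

Section Moebius.

Lemma big_dvdn (V : nmodType) m (Q : pred nat) (G : nat -> V) : (0 < m)%N ->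
  \sum_(1 <= d < m.+1 | (d %| m)%N && Q d) G d = \sum_(d <- divisors m | Q d) G d.
Proof.
move=> m_gt0; rewrite -[LHS]big_filter -[RHS]big_filter; apply/perm_big/uniq_perm.
- by rewrite filter_uniq // iota_uniq.
- by rewrite filter_uniq // divisors_uniq.
move=> d; rewrite !mem_filter -dvdn_divisors // mem_index_iota ltnS.
case: (boolP (d %| m)%N) => dm; rewrite ?andbF //=.
by rewrite (dvdn_gt0 m_gt0 dm) (dvdn_leq m_gt0 dm) ?andbT.
Qed.

Lemma divisors_muln (V : nmodType) m d (G : nat -> V) : (0 < m)%N -> (d %| m)%N ->
  \sum_(g <- divisors (m %/ d)) G (d * g)%N =
    \sum_(c <- divisors m | (d %| c)%N) G c.
Proof.
move=> m_gt0 dm; have d_gt0 := dvdn_gt0 m_gt0 dm.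
have md_gt0 : (0 < m %/ d)%N by rewrite divn_gt0 // dvdn_leq.
rewrite -(big_map (muln d) xpredT G) -[RHS]big_filter; apply/perm_big/uniq_perm.
- rewrite map_inj_uniq ?divisors_uniq // => u v /eqP.
  by rewrite eqn_pmul2l // => /eqP.
- by rewrite filter_uniq // divisors_uniq.
move=> c; rewrite mem_filter -dvdn_divisors //; apply/mapP/andP => [[g]|[/dvdnP[g ->] gm]].
  by rewrite -dvdn_divisors // dvdn_divRL // => gm ->; rewrite dvdn_mulr // mulnC.
by exists g; rewrite 1?mulnC // -dvdn_divisors // dvdn_divRL.
Qed.

Lemma moebius_eq0 p d : prime p -> (0 < d)%N -> (p ^ 2 %| d)%N -> moebius d = 0.
Proof.
move=> pp d_gt0 pd; rewrite /moebius; case: ifP => // /allP/(_ p).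
rewrite mem_primes pp d_gt0 pd (dvdn_trans _ pd) ?dvdn_exp //.
by move=> /(_ isT).
Qed.

Lemma moebius_mul p d : prime p -> (0 < d)%N -> ~~ (p %| d)%N ->
  moebius (p * d) = - moebius d.
Proof.
move=> pp d_gt0 pd; have p_gt0 := prime_gt0 pp.
have prE : perm_eq (primes (p * d)) (p :: primes d).
  apply: uniq_perm; rewrite /= ?primes_uniq ?andbT //.
    by rewrite mem_primes pp d_gt0.
  by move=> q; rewrite primesM // primes_prime // !inE.
rewrite /moebius (perm_all _ prE) (perm_size prE) /= exprS mulN1r.
have -> : ~~ (p ^ 2 %| p * d)%N by rewrite expnS expn1 dvdn_pmul2l.
rewrite (eq_in_all (a2 := fun q => ~~ (q ^ 2 %| d)%N)) /=.
  by case: ifP; rewrite ?oppr0.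
move=> q; rewrite mem_primes => /and3P[pq _ qd]; rewrite Gauss_dvdr //.
rewrite coprimeXl // prime_coprime // dvdn_prime2 //.
by apply: contra pd => /eqP <-.
Qed.

(** Fix a prime [p] dividing [m]. Divisors [p * d] with [p] dividing [d] contribute 0, and those
    with [d] prime to [p] cancel against [d] itself. *)
Lemma sum_moebius m : (0 < m)%N -> \sum_(d <- divisors m) moebius d = (m == 1%N)%:R.
Proof.
move=> m_gt0; have [->|m_neq1] := eqVneq m 1%N; first by rewrite big_seq1.
have m_gt1 : (1 < m)%N by case: m m_gt0 m_neq1 => [|[]].
pose p := pdiv m; have pp : prime p by apply: pdiv_prime.
have pm : (p %| m)%N by apply: pdiv_dvd.
have mp_gt0 : (0 < m %/ p)%N by rewrite divn_gt0 ?prime_gt0 // dvdn_leq.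
rewrite (bigID (dvdn p)) /= -divisors_muln // (bigID (dvdn p)) /= big_seq_cond.
rewrite big1 ?add0r => [|d /andP[]]; last first.
  rewrite -dvdn_divisors // => dmp pd; apply: (moebius_eq0 pp).
    by rewrite muln_gt0 prime_gt0 // (dvdn_gt0 mp_gt0 dmp).
  by rewrite expnS expn1 dvdn_pmul2l ?prime_gt0.
rewrite big_seq_cond (eq_bigr (fun d => - moebius d)) => [|d /andP[]]; last first.
  rewrite -dvdn_divisors // => dmp pd.
  by rewrite moebius_mul // (dvdn_gt0 mp_gt0 dmp).
rewrite -big_seq_cond sumrN addrC.
(* The divisors prime to [p] are the same for [m] and for [m %/ p]. *)
apply/eqP; rewrite subr_eq0 -[X in _ == X]big_filter -[X in X == _]big_filter; apply/eqP.
apply/perm_big/uniq_perm; rewrite ?filter_uniq ?divisors_uniq //.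
move=> d; rewrite !mem_filter -!dvdn_divisors //; case: (boolP (p %| d)%N) => //= pd.
apply/idP/idP => [dm|/dvdn_trans]; last by apply; apply: dvdn_div.
rewrite -(@Gauss_dvdr _ p) 1?mulnC ?divnK //.
by rewrite coprime_sym prime_coprime.
Qed.

(** Collect terms by [c = d * g]: the coefficient of [h c] is the Moebius sum over the divisors of
    [c], which leaves only [c = 1]. *)
Lemma moebius_inversion (h : nat -> rat) m : (0 < m)%N ->
  \sum_(d <- divisors m) (moebius d)%:~R *
     (\sum_(g <- divisors (m %/ d)) h (d * g)%N) = h 1%N.
Proof.
move=> m_gt0; rewrite big_seq.
rewrite (eq_bigr (fun d => \sum_(c <- divisors m | (d %| c)%N)
                             (moebius d)%:~R * h c)); last first.
  by move=> d; rewrite -dvdn_divisors // => dm; rewrite divisors_muln // big_distrr.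
rewrite -big_seq (exchange_big_dep xpredT) //=.
rewrite big_seq (eq_bigr (fun c => (c == 1%N)%:R * h c)) => [|c]; last first.
  rewrite -dvdn_divisors // => cm; have c_gt0 := dvdn_gt0 m_gt0 cm.
  rewrite -big_distrl /= -rmorph_sum /=; congr (_ * _).
  rewrite -[RHS](rmorph_nat intr) -sum_moebius //; congr (_%:~R).
  rewrite -[LHS]big_filter; apply/perm_big/uniq_perm; rewrite ?filter_uniq ?divisors_uniq //.
  move=> d; rewrite !mem_filter -!dvdn_divisors //; apply/andP/idP => [[]//|dc].
  by split=> //; apply: dvdn_trans cm.
rewrite -big_seq (bigD1_seq 1%N) ?divisors_uniq -?dvdn_divisors //= mul1r.
by rewrite big1 ?addr0 // => c /negbTE ->; rewrite mul0r.
Qed.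

End Moebius.

(** * Counting necklaces *)

Section Necklaces.
Variables a T : nat.
Local Notation word := (word a T).
Local Notation rho := (@rho a T).
Implicit Types (x : word) (C : {set word}) (r : 'I_a -> nat).

(** The first letters of the distinct rotations spell one primitive period, so this is the content
    of the primitive necklace. *)
Definition orbit_content C j := (\sum_(x in C) (letter x 0 == j))%N.

Definition necklaces r := [set C in porbits rho | [forall j, orbit_content C j == r j]].

Lemma sum_orbit_content C : (\sum_j orbit_content C j)%N = #|C|.
Proof.
rewrite exchange_big -sum1_card /=; apply: eq_bigr => x _.
rewrite (bigD1 (letter x 0)) //= eqxx big1 // => j.
by rewrite eq_sym => /negbTE ->.
Qed.

Lemma orbit_content_period x m j : (#|porbit rho x| %| m)%N ->
  (\sum_(t < m) (letter x t == j) = m %/ #|porbit rho x| * orbit_content (porbit rho x) j)%N.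
Proof.
move=> /dvdnP[q ->]; rewrite mulnK; last by rewrite lt0n card_porbit_neq0.
rewrite /orbit_content big_porbit.
elim: q => [|q IHq]; first by rewrite big_ord0.
rewrite mulSnr mulSn big_split_ord /= IHq [RHS]addnC; congr (_ + _)%N.
apply: eq_bigr => t _; rewrite -(iter_porbit_mul rho x q) letter_iter.
by rewrite add0n.
Qed.

(** A word of length [m] extends periodically to length [T.+1]; conversely a word with period
    dividing [m] is determined by its first [m] letters. *)
Lemma card_words_period m r : (0 < m)%N -> (m %| T.+1)%N ->
  #|has_content (n := m) r| =
  #|[pred x : word | (#|porbit rho x| %| m)%N &&
      [forall j, (m %/ #|porbit rho x| * orbit_content (porbit rho x) j == r j)%N]]|.
Proof.
move=> m_gt0 mT; pose w x := [tuple letter x t | t < m].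
have cw x j : count_mem j (w x) = (\sum_(t < m) (letter x t == j))%N.
  rewrite /w /= count_map -sumn_count sumnE big_map.
  by rewrite big_enum /=.
have letter_modm x t : iter m rho x = x -> letter x (t %% m) = letter x t.
  move=> xm; rewrite {2}(divn_eq t m); elim: (t %/ m)%N => [//|q ->].
  by rewrite mulSn -addnA [(m + _)%N]addnC -(letter_iter x m) xm.
rewrite -(card_in_imset (f := w)) => [|x y]; last first.
  move=> /andP[/=]; rewrite -iter_eq_dvdn => /eqP xm _ /andP[/=].
  rewrite -iter_eq_dvdn => /eqP ym _ /(congr1 (fun v => tnth v)) xy.
  apply: letter_ext => t; rewrite -letter_modm // -[RHS]letter_modm //.
  have tm : (t %% m < m)%N by rewrite ltn_mod.
  by have := congr1 (fun f => f (Ordinal tm)) xy; rewrite !tnth_mktuple.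
apply: eq_card => v; apply/idP/imsetP => [/forallP vr|[x /andP[/= xm /forallP xr] ->]].
  pose f t := nth (tnth v (Ordinal m_gt0)) v (t %% m).
  have fm t : f (t + m)%N = f t by rewrite /f modnDr.
  pose x := word_of T f.
  have xE t : letter x t = f t.
    apply: letter_word_of => {}t; have /dvdnP[q ->] := mT.
    by elim: q => [|q IHq]; rewrite ?addn0 // mulSnr addnA fm.
  have wx : v = w x.
    apply: eq_from_tnth => t; rewrite tnth_mktuple xE /f modn_small //.
    exact: tnth_nth.
  exists x => //; have xm : (#|porbit rho x| %| m)%N.
    rewrite -iter_eq_dvdn; apply/eqP/letter_ext => t.
    by rewrite letter_iter !xE fm.
  rewrite inE xm /=; apply/forallP => j.
  by rewrite -orbit_content_period // -cw -wx.
by apply/forallP => j; rewrite cw orbit_content_period.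
Qed.

(** An orbit of content [r] has as many elements as the sum of the [r j]. *)
Lemma card_primitive r : 
  (#|[pred x : word | [forall j, orbit_content (porbit rho x) j == r j]]| =
     (\sum_j r j) * #|necklaces r|)%N.
Proof.
rewrite -[LHS]sum1_card [LHS]big_mkcond (big_porbits rho) /= mulnC -sum_nat_const.
rewrite [LHS]big_mkcond [RHS]big_mkcond /=; apply: eq_bigr => C _.
rewrite inE; case: (boolP (C \in porbits rho)) => //= Crho.
rewrite (eq_bigr (fun _ => [forall j, orbit_content C j == r j] : nat)); last first.
  move=> x; rewrite -(porbit_in _ Crho) => /eqP <-.
  by rewrite inE; case: ifP.
rewrite sum_nat_const -sum_orbit_content; case: forallP => [rE|_]; last by rewrite muln0.
by rewrite muln1; apply: eq_bigr => j _; apply/eqP.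
Qed.

(** Each word of content [r] is a unique power of a primitive word; the exponent [g] divides the gcd
    [D] of the contents, and the root has content [r / g]. *)
Lemma card_words_primitive r D (m := (\sum_j r j)%N) :
    (forall g, (g %| D)%N = [forall j, (g %| r j)%N]) ->
    (0 < m)%N -> (m %| T.+1)%N ->
  #|has_content (n := m) r| =
    (\sum_(g <- divisors D)
      #|[pred x : word | [forall j, orbit_content (porbit rho x) j == r j %/ g]]|)%N.
Proof.
move=> DP m_gt0 mT; have Dm : (D %| m)%N.
  by apply: dvdn_sum => j _; move: j; apply/forallP; rewrite -DP.
have D_gt0 := dvdn_gt0 m_gt0 Dm.
rewrite card_words_period //.
rewrite (eq_bigr (fun g => \sum_(x : word) [forall j, orbit_content (porbit rho x) j == r j %/ g])%N).
  rewrite exchange_big -sum1_card big_mkcond; apply: eq_bigr => x _ /=.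
  rewrite inE; set d := #|porbit rho x|; set P := _ && _.
  have d_gt0 : (0 < d)%N by rewrite lt0n card_porbit_neq0.
  (* For a given [x] with orbit of size [d], only the exponent [g = m / d] can contribute. *)
  rewrite big_seq (eq_bigr (fun g => P && (g == m %/ d)%N : nat)) => [|g].
    rewrite -big_seq; case: (boolP P) => [/andP[dm /forallP rE]|_]; last by rewrite big1.
    rewrite (bigD1_seq (m %/ d)%N) ?divisors_uniq //=.
      by rewrite eqxx big1 // => g /negbTE ->.
    rewrite -dvdn_divisors // DP; apply/forallP => j.
    by rewrite -(eqP (rE j)) dvdn_mulr.
  rewrite -dvdn_divisors // => gD; have g_gt0 := dvdn_gt0 D_gt0 gD.
  move: gD; rewrite DP => /forallP gr; congr (nat_of_bool _).
  apply/forallP/andP => [rE|[/andP[dm /forallP rE] /eqP gE] j].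
    have rE' j : r j = (g * orbit_content (porbit rho x) j)%N.
      by rewrite (eqP (rE j)) mulnC divnK.
    have mE : m = (g * d)%N.
      by rewrite /m (eq_bigr _ (fun j _ => rE' j)) -big_distrr /= sum_orbit_content.
    rewrite /P mE dvdn_mull // mulnK // eqxx; split=> //.
    by apply/forallP => j; rewrite -rE'.
  by rewrite -(eqP (rE j)) -gE mulKn.
by move=> g _; rewrite -sum1_card big_mkcond; apply: eq_bigr => x _; rewrite inE; case: ifP.
Qed.

(** The multinomial at [d] counts words of content [r / d], a sum of primitive counts [h (d * g)].
    Moebius inversion over the divisors of the gcd leaves [h 1], which is [m] times the number of
    necklaces. *)
Lemma necklaceM_card r (m := (\sum_j r j)%N) : (0 < m)%N -> (m %| T.+1)%N ->
  necklaceM r = #|necklaces r|%:R.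
Proof.
move=> m_gt0 mT; pose D := \big[gcdn/0%N]_j r j.
have DP g : (g %| D)%N = [forall j, (g %| r j)%N].
  by apply/dvdn_biggcdP/forallP => [gr j|gr j _]; apply: gr.
have Dm : (D %| m)%N.
  by apply: dvdn_sum => j _; move: j; apply/forallP; rewrite -DP.
have D_gt0 := dvdn_gt0 m_gt0 Dm.
pose h c : rat :=
  #|[pred x : word | [forall j, orbit_content (porbit rho x) j == r j %/ c]]%N|%:R.
have <- : m%:R^-1 * h 1%N = #|necklaces r|%:R.
  rewrite /h (eq_card (B := [pred x : word | [forall j, orbit_content (porbit rho x) j == r j]])).
    by rewrite card_primitive natrM mulKf // pnatr_eq0 -lt0n.
  by move=> x; rewrite !inE; apply: eq_forallb => j; rewrite divn1.
rewrite /necklaceM -/m; congr (_ * _).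
rewrite big_dvdn // -(moebius_inversion h D_gt0).
rewrite -[LHS]big_filter (perm_big (divisors D)) /=; last first.
  apply: uniq_perm; rewrite ?filter_uniq ?divisors_uniq // => d.
  rewrite mem_filter -!dvdn_divisors // -DP.
  by apply/andP/idP => [[]//|dD]; split=> //; apply: dvdn_trans Dm.
rewrite !big_seq; apply: eq_bigr => d; rewrite -dvdn_divisors // => dD.
have d_gt0 := dvdn_gt0 D_gt0 dD.
have dr j : (d %| r j)%N by move: j; apply/forallP; rewrite -DP.
have md : (\sum_j r j %/ d)%N = (m %/ d)%N.
  by apply/eqP; rewrite -(eqn_pmul2r d_gt0) divnK ?(dvdn_trans dD) // big_distrl /=;
     apply/eqP/eq_bigr => j _; rewrite divnK.
congr (_ * _); rewrite -(card_words_multinomial _ md) -md.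
rewrite (card_words_primitive (D := D %/ d)) ?md.
- rewrite natr_sum; apply: eq_bigr => g _; congr (_%:R); apply: eq_card => x.
  by rewrite !inE; apply: eq_forallb => j; rewrite divnMA.
- move=> g; rewrite dvdn_divRL // DP; apply: eq_forallb => j.
  by rewrite dvdn_divRL.
- by rewrite divn_gt0 // dvdn_leq // (dvdn_trans dD).
- by apply: dvdn_trans mT; rewrite dvdn_div // (dvdn_trans dD).
Qed.
End Necklaces.

(** * The u-adic topology on power series *)

Section UAdic.
Variable R : comNzRingType.
Local Notation series := (mfps R nat).
Implicit Types (f g y : series) (m : {cmonom nat}).

(* [f] lies in the ideal generated by [u ^+ K]; [m 0] is the exponent of [u]. *)
Definition vanish K f := forall m, (m 0 < K)%N -> mcoef f m = 0.

Lemma vanishD K f g : vanish K f -> vanish K g -> vanish K (f + g).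
Proof. by move=> fK gK m mK; rewrite mcoefD fK // gK // addr0. Qed.

Lemma vanishN K f : vanish K f -> vanish K (- f).
Proof. by move=> fK m mK; rewrite mcoefN fK // oppr0. Qed.

Lemma vanishB K f g : vanish K f -> vanish K g -> vanish K (f - g).
Proof. by move=> fK gK; apply: vanishD => //; apply: vanishN. Qed.

Lemma vanish_sum K (I : Type) (r : seq I) (P : pred I) (F : I -> series) :
  (forall i, P i -> vanish K (F i)) -> vanish K (\sum_(i <- r | P i) F i).
Proof. by move=> FK; apply: (big_ind (vanish K)) => //; exact: vanishD. Qed.

Lemma vanishM j k f g : vanish j f -> vanish k g -> vanish (j + k) (f * g).
Proof.
move=> fj gk m mjk; rewrite mcoefM; apply: fsbigop.fsbig1 => -[m1 m2] /= m12.
move: mjk; rewrite -m12 cmM; have [m1j _|jm1 mjk] := ltnP (m1 0) j.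
  by rewrite fj ?mul0r.
rewrite [mcoef g _]gk ?mulr0 //; rewrite -(ltn_add2l j).
by apply: leq_ltn_trans mjk; rewrite leq_add2r.
Qed.

Lemma vanishMl k f g : vanish k g -> vanish k (f * g).
Proof. by move=> gk; rewrite -[k]add0n; apply: vanishM. Qed.

Lemma vanishMr k f g : vanish k f -> vanish k (f * g).
Proof. by move=> gk; rewrite -[k]addn0; apply: vanishM. Qed.

Lemma vanishZ k c f : vanish k f -> vanish k (c *: f).
Proof. by move=> fk m mk; rewrite mcoefZ fk // mulr0. Qed.

Lemma vanishX j k f : vanish j f -> vanish (k * j) (f ^+ k).
Proof. by move=> fj; elim: k => // k IHk; rewrite mulSn exprS; apply: vanishM. Qed.

Lemma vanish_prod (I : Type) (r : seq I) (P : pred I) (v : I -> nat) (F : I -> series) :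
  (forall i, P i -> vanish (v i) (F i)) ->
  vanish (\sum_(i <- r | P i) v i) (\prod_(i <- r | P i) F i).
Proof. by move=> vF; apply: (big_rec2 vanish) => // i k f /vF; exact: vanishM. Qed.

Lemma vanish_le j k f : (j <= k)%N -> vanish k f -> vanish j f.
Proof. by move=> jk fk m mj; apply: fk; apply: leq_trans jk. Qed.

Lemma vanish_u : vanish 1 (ser_u R).
Proof.
move=> m; rewrite ltnS leqn0 => /eqP m0; rewrite /mcoef /ser_u /mfpsX.
by case: eqP => // mE; move: m0; rewrite mE cmU eqxx.
Qed.

Lemma vanish_all f : (forall K, vanish K f) -> f = 0.
Proof. by move=> fK; apply/mfpsP => m; rewrite (fK (m 0).+1). Qed.

Lemma vanish_trans K f g h : vanish K (f - g) -> vanish K (g - h) -> vanish K (f - h).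
Proof. by move=> /vanishD fg /fg; rewrite addrA subrK. Qed.

Lemma vanishB_prod K (I : Type) (r : seq I) (P : pred I) (F G : I -> series) :
  (forall i, P i -> vanish K (F i - G i)) ->
  vanish K (\prod_(i <- r | P i) F i - \prod_(i <- r | P i) G i).
Proof.
move=> FG; apply: (big_rec2 (fun f g => vanish K (f - g))).
  by rewrite subrr.
move=> i f g /FG FGi fg; have -> : F i * f - G i * g = (F i - G i) * f + G i * (f - g).
  by rewrite mulrBl mulrBr addrA subrK.
by apply: vanishD; [apply: vanishMr|apply: vanishMl].
Qed.

(** The inverse is the geometric series. Since [y ^+ k] is divisible by the [k]-th power of [u],
    each coefficient is read off a finite partial sum. *)
Lemma unit_subr1 y : vanish 1 y -> 1 - y \is a GRing.unit.
Proof.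
move=> y1; have yX k : vanish k (y ^+ k) by rewrite -[k in vanish k]muln1; apply: vanishX.
pose S K := \sum_(k < K) y ^+ k.
pose g : series := fun m => mcoef (S (m 0).+1) m.
have gS K : vanish K (g - S K).
  move=> m mK; rewrite mcoefD mcoefN {1}/mcoef /g /S -(subnKC mK) [in X in _ - X]big_split_ord.
  rewrite mcoefD opprD addrA subrr sub0r (_ : mcoef _ m = 0) ?oppr0 //.
  by apply: (@vanish_sum (m 0).+1) => // i _; apply: vanish_le (yX _); rewrite leq_addr.
apply/unitrPr; exists g; apply/eqP; rewrite -subr_eq0; apply/eqP/vanish_all => K.
have -> : (1 - y) * g - 1 = (1 - y) * (g - S K) - y ^+ K.
  rewrite mulrBr -addrA; congr (_ + _).
  by rewrite -[1 - y]opprB mulNr -subrX1 opprK addrAC subrr add0r.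
by apply: vanishB => //; apply: vanishMl.
Qed.

Lemma geometric K y : vanish 1 y ->
  vanish K ((1 - y)^-1 - \sum_(k < K) y ^+ k).
Proof.
move=> y1; have -> : (1 - y)^-1 - \sum_(k < K) y ^+ k = (1 - y)^-1 * y ^+ K.
  apply: (mulrI (unit_subr1 y1)); rewrite mulrBr mulVKr ?unit_subr1 //.
  rewrite divrr ?unit_subr1 // -[X in X * _]opprB mulNr -subrX1.
  by rewrite opprK addrC subrK.
by apply: vanishMl; rewrite -[X in vanish X]muln1; apply: vanishX.
Qed.

Lemma inv_subr1 K y : vanish 1 y -> vanish K y -> vanish K ((1 - y)^-1 - 1).
Proof.
move=> y1 yK; have -> : (1 - y)^-1 - 1 = (1 - y)^-1 * y; last exact: vanishMl.
apply: (mulrI (unit_subr1 y1)); rewrite mulrBr mulVKr ?unit_subr1 //.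
by rewrite divrr ?unit_subr1 // mulr1 opprB addrC subrK.
Qed.

(** [L] is Cauchy in the [u]-adic sense: its coefficient at [m] is final from index [m 0 + 1] on.
    [M N] agrees with [L N.+1] through degree [N] in [u], hence has the same limit. *)
Lemma vanish_cvg (L M : nat -> series) :
    (forall N, vanish N (L N.+1 - L N)) -> (forall N, vanish N.+1 (L N.+1 - M N)) ->
  exists F, mfps_cvg L F /\ mfps_cvg M F.
Proof.
move=> LL LM; pose F : series := fun m => mcoef (L (m 0).+1) m.
have LE m n : (m 0 < n)%N -> mcoef (L n) m = mcoef F m.
  elim: n => // n IHn; rewrite ltnS leq_eqVlt => /orP[/eqP <- //|mn].
  by rewrite -IHn //; apply/eqP; rewrite -subr_eq0 -mcoefN -mcoefD LL.
exists F; split=> m; first by exists (m 0).+1 => n; apply: LE.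
exists (m 0) => n mn; rewrite -(LE m n.+1) //; apply/eqP.
by rewrite eq_sym -subr_eq0 -mcoefN -mcoefD LM.
Qed.

End UAdic.

(** * Cycles and necklaces *)

Section Cycles.
Variables a T n : nat.
Hypothesis n_le : forall i, (0 < i <= n)%N -> (i %| T.+1)%N.
Local Notation word := (word a T).
Local Notation rho := (@rho a T).
Local Notation read := (@read a T n).
Implicit Types (s : 'S_n) (F : 'I_n -> 'I_a).

Lemma read_iter s F k i : read s F (iter i s k) = iter i rho (read s F k).
Proof. by elim: i => //= i <-; rewrite rho_read. Qed.

Lemma imset_read_porbit s F k : read s F @: porbit s k = porbit rho (read s F k).
Proof.
apply/setP => x; apply/imsetP/porbitP => [[l /porbitP[i ->] ->]|[i ->]].
  by exists i; rewrite !permX read_iter.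
by exists ((s ^+ i)%g k); rewrite ?mem_porbit // !permX read_iter.
Qed.

(* [s] increases along a fibre of [read s F], so a cycle meeting a fibre twice
   would never close up. *)
Lemma read_inj_porbit s F k l : stdpair s F -> l \in porbit s k ->
  read s F k = read s F l -> k = l.
Proof.
move=> sF /porbitP[d ->]; rewrite permX => kd.
have itlt i (k' l' : 'I_n) : (k' < l')%N -> read s F k' = read s F l' ->
    (iter i s k' < iter i s l')%N.
  move=> kl' eqr; elim: i => //= i /(read_lt n_le sF); apply.
  by rewrite !read_iter eqr.
have xT : iter (T.+1 * d) s k = k.
  by rewrite mulnC; elim: (d) => // i IHi; rewrite mulSn iterD IHi (iter_perm_id n_le).
pose x i := nat_of_ord (iter (i * d) s k).
case: (ltngtP k (iter d s k)) => [lt|gt|/val_inj//].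
  have /(_ 0%N T.+1 isT) : {homo x : i j / (i < j)%N}.
    apply: homo_ltn; first exact: ltn_trans.
    by move=> i; rewrite /x mulSnr iterD; apply: itlt.
  by rewrite /x xT ltnn.
have /(_ 0%N T.+1 isT) : {homo x : i j / (i < j)%N >-> (j < i)%N}.
  apply: homo_ltn; first by move=> i j m ij jm; apply: ltn_trans jm ij.
  by move=> i; rewrite /x mulSnr iterD; apply: itlt.
by rewrite /x xT ltnn.
Qed.

Definition mult s F (C : {set word}) :=
  #|[set O in porbits s | read s F @: O == C]|.

(** A cycle whose necklace is the orbit of [x] contains exactly one position reading [x], so such
    positions correspond to such cycles. *)
Lemma card_read s F x : stdpair s F ->
  #|[pred k | read s F k == x]| = mult s F (porbit rho x).
Proof.
move=> sF; rewrite -(card_in_imset (f := porbit s)) => [|k l /eqP/= kx /eqP/= lx /eqP].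
  apply: eq_card => O; rewrite [RHS]inE; apply/imsetP/andP => [[k /eqP/= <- ->]|[]].
    by rewrite imset_f // imset_read_porbit.
  move=> /imsetP[k _ ->] /eqP kx; have := porbit_id rho x.
  rewrite -kx => /imsetP[l lk ->]; exists l; first by rewrite inE.
  by apply/eqP; rewrite eq_porbit_mem porbit_sym.
by rewrite eq_porbit_mem porbit_sym => /(read_inj_porbit sF); apply; rewrite kx lx.
Qed.

Section Weights.
Variables (R : comNzRingType) (p : 'I_a -> R).

(** Generic in [X], to serve both the cycles of [s] and the orbits of words. *)
Definition weight (X : finType) (f : X -> 'I_a) (C : {set X}) : mfps R nat :=
  (\prod_(x in C) p (f x)) *: (ser_u R ^+ #|C| * ser_x R #|C|).

Definition word_weight (C : {set word}) := weight (fun x : word => letter x 0%N) C.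

Lemma weight_read s F O : stdpair s F -> O \in porbits s ->
  weight F O = word_weight (read s F @: O).
Proof.
move=> sF /imsetP[k _ ->].
have inj : {in porbit s k &, injective (read s F)}.
  move=> i j; rewrite -eq_porbit_mem => /eqP <- ji.
  exact: read_inj_porbit sF ji.
rewrite /word_weight /weight card_in_imset // big_imset //=.
by congr (_ *: _); apply: eq_bigr => i _; rewrite (letter_read n_le).
Qed.

Lemma cycle_term s F : 
  ser_u R ^+ n * ((\prod_k p (F k)) *: \prod_(1 <= i < n.+1) ser_x R i ^+ ncycles i s) =
    \prod_(O in porbits s) weight F O.
Proof.
rewrite -scalerAr /weight scaler_prod big_split /= (big_porbits s).
rewrite -expr_sum sum_card_porbits card_ord; congr (_ *: (_ * _)).
rewrite (eq_bigr (fun i => \prod_(O in porbits s | #|O| == i) ser_x R #|O|)).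
  rewrite prod_by_card => [|C]; last exact: card_porbits_gt0.
  apply: eq_bigl => O; rewrite andb_idr // => _.
  by rewrite -[X in (_ <= X)%N]card_ord max_card.
move=> i _; rewrite (eq_bigr (fun _ => ser_x R i)) => [|O /andP[_ /eqP->]//].
by rewrite prodr_const; congr (_ ^+ _); apply: eq_card => O; rewrite !inE.
Qed.

Lemma prod_weight s F : stdpair s F ->
  \prod_(O in porbits s) weight F O = \prod_(C in porbits rho) word_weight C ^+ mult s F C.
Proof.
move=> sF; rewrite [LHS](partition_big (fun O : {set _} => read s F @: O) [in porbits rho]) /=; last first.
  by move=> O /imsetP[k _ ->]; rewrite imset_read_porbit imset_f.
apply: eq_bigr => C _; rewrite (eq_bigr (fun _ => word_weight C)) => [|O /andP[Os /eqP <-]].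
  by rewrite prodr_const; congr (_ ^+ _); apply: eq_card => O; rewrite !inE.
exact: weight_read.
Qed.

Definition pweight K (m : {ffun {set word} -> 'I_K.+1}) :=
  (\sum_(C in porbits rho) m C * #|C|)%N.

(** The bijection in generating-function form: a standard pair is sent to the multiplicity [m C] of
    each necklace [C]. Bounding multiplicities by [K] makes the index type finite and loses nothing,
    as there are at most [n] cycles. *)
Lemma sum_stdpair K : (n <= K)%N ->
  \sum_s \sum_(F : {ffun 'I_n -> 'I_a} | stdpair s F)
     ser_u R ^+ n * ((\prod_k p (F k)) *: \prod_(1 <= i < n.+1) ser_x R i ^+ ncycles i s) =
  \sum_(m in pffun_on (@ord0 K) [in porbits rho] predT | pweight m == n)
     \prod_(C in porbits rho) word_weight C ^+ m C.
Proof.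
move=> nK.
have multK s F C : (mult s F C < K.+1)%N.
  rewrite ltnS (leq_trans _ nK) // -[X in (_ <= X)%N]card_ord.
  rewrite /mult; apply: leq_trans (leq_imset_card (porbit s) _).
  by apply/subset_leq_card/fintype.subsetP => O; rewrite inE => /andP[].
pose mu (q : 'S_n * {ffun 'I_n -> 'I_a}) : {ffun {set word} -> 'I_K.+1} :=
  [ffun C => if C \in porbits rho then Ordinal (multK q.1 q.2 C) else ord0].
have muE s (F : {ffun 'I_n -> 'I_a}) x : stdpair s F ->
    mu (s, F) (porbit rho x) = #|[pred k | read s F k == x]| :> nat.
  by move=> sF; rewrite ffunE imset_f //= card_read.
rewrite pair_big_dep /=.
rewrite (partition_big mu (fun m => (m \in pffun_on (@ord0 K) [in porbits rho] predT)
   && (pweight m == n))) /=; last first.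
  move=> [s F] /= sF; apply/andP; split.
    apply/pffun_onP; split=> [|//]; apply/supportP => C CP.
    by rewrite ffunE (negbTE CP).
  rewrite -[X in _ == X]card_ord -sum1_card.
  rewrite [X in _ == X](partition_big (read s F) xpredT) //= (big_porbits rho) /=.
  apply/eqP/eq_bigr => C /imsetP[x _ ->].
  rewrite mulnC -sum_nat_const; apply: eq_bigr => y.
  rewrite -eq_porbit_mem => /eqP <-; rewrite muE // sum1_card.
  by apply: eq_card => k; rewrite !inE.
apply: eq_bigr => m /andP[/pffun_onP[/supportP msup _] /eqP mn].
(* Each word gets the multiplicity of its orbit; the pair rebuilt from this multiset is the only one
   in the fibre of [mu] over [m]. *)
have [||s [F [sF Fm]]] := @read_ex a T n n_le (fun x => m (porbit rho x)).
- by move=> x; rewrite -[rho x]/(iter 1 rho x) -permX porbit_perm.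
- rewrite -[RHS]mn (big_porbits rho) /=; apply: eq_bigr => C CP.
  rewrite (eq_bigr (fun _ => m C : nat)); first by rewrite sum_nat_const mulnC.
  by move=> x; rewrite -(porbit_in _ CP) => /eqP ->.
have muF : mu (s, F) = m.
  apply/ffunP => C; case: (boolP (C \in porbits rho)) => [/imsetP[x _ ->]|CP].
    by apply: ord_inj; rewrite muE // Fm.
  by rewrite ffunE (negbTE CP) msup.
rewrite (big_pred1 (s, F)) => [|[s' F'] /=].
  rewrite cycle_term prod_weight // -muF; apply: eq_bigr => C CP.
  by rewrite ffunE CP.
apply/andP/eqP => [[sF' /eqP mu']|[-> ->]]; last by rewrite muF.
have [x|-> FF'] := read_uniq n_le sF' sF; first by rewrite -!muE // mu' muF.
by congr (_, _); apply/ffunP.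
Qed.

End Weights.
End Cycles.

(** * The identity modulo powers of [u], and the limit *)

Lemma riffle_expect_cycles (R : numFieldType) a n K T (p : 'I_a -> R) :
    (0 < a)%N -> (n <= K)%N -> (forall i, (0 < i <= K)%N -> (i %| T.+1)%N) ->
  ser_u R ^+ n *
     riffle_expect p (fun s : 'S_n => \prod_(1 <= i < n.+1) ser_x R i ^+ ncycles i s) =
  \sum_(m in pffun_on (@ord0 K) [in porbits (@rho a T)] predT | pweight m == n)
     \prod_(C in porbits (@rho a T)) word_weight p C ^+ m C.
Proof.
move=> a_gt0 nK K_dvd.
have n_dvd i : (0 < i <= n)%N -> (i %| T.+1)%N.
  by move=> /andP[i0 /leq_trans/(_ nK) iK]; apply: K_dvd; rewrite i0.
(* The probability involves the inverse of [s]; inversion preserves the cycles. *)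
rewrite -(sum_stdpair n_dvd p nK) /riffle_expect (reindex_inj invg_inj) mulr_sumr.
apply: eq_bigr => s _; rewrite riffle_prob_stdpair // invgK scaler_suml mulr_sumr.
apply: eq_bigr => F _; congr (_ * (_ *: _)); apply: eq_bigr => i _.
by rewrite /ncycles porbitsV.
Qed.

Lemma vanish_word_weight (R : comNzRingType) a T (p : 'I_a -> R) (C : {set word a T}) :
  vanish #|C| (word_weight p C).
Proof.
apply: vanishZ; apply: vanishMr; rewrite -[X in vanish X]muln1.
exact/vanishX/vanish_u.
Qed.

(** All orbits of content [r] have the same weight, and [necklaceM r] is their number. *)
Lemma necklace_factors (R : numFieldType) a K T (p : 'I_a -> R) :
    (forall i, (0 < i <= K)%N -> (i %| T.+1)%N) ->
  \prod_(1 <= i < K.+1)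
     \prod_(r : {ffun 'I_a -> 'I_i.+1} | (\sum_(j < a) r j)%N == i)
        (1 / (1 - (\prod_(j < a) p j ^+ r j) *: (ser_u R ^+ i * ser_x R i)))
          ^+ Num.truncn (necklaceM (fun j => r j)) =
  \prod_(C in porbits (@rho a T) | (#|C| <= K)%N) (1 - word_weight p C)^-1.
Proof.
move=> K_dvd; rewrite -prod_by_card => [|C]; last exact: card_porbits_gt0.
rewrite big_nat [RHS]big_nat; apply: eq_bigr => i /andP[i_gt0 iK].
(* The cap makes the content an element of ['I_i.+1] for every set [C]; it has no effect on orbits
   of size [i]. *)
have ltC (C : {set word a T}) j : (minn (orbit_content C j) i < i.+1)%N by rewrite ltnS geq_minr.
pose c (C : {set word a T}) : {ffun 'I_a -> 'I_i.+1} := [ffun j => Ordinal (ltC C j)].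
have cE (C : {set word a T}) j : #|C| = i -> c C j = orbit_content C j :> nat.
  move=> Ci; rewrite ffunE /=; apply/minn_idPl.
  by rewrite -Ci -sum_orbit_content (bigD1 j) //= leq_addr.
rewrite [RHS](partition_big c (fun r => \sum_(j < a) r j == i)%N) /=; last first.
  move=> C /andP[_ /eqP Ci]; rewrite -[X in _ == X]Ci -sum_orbit_content.
  by apply/eqP/eq_bigr => j _; rewrite cE.
apply: eq_bigr => r /eqP ri.
rewrite (@necklaceM_card a T) ?ri //; last by apply: K_dvd; rewrite i_gt0.
rewrite natrK -prodr_const; apply: eq_big => C.
  rewrite inE -andbA; apply: andb_id2l => CP; apply/forallP/andP => [Cr|[/eqP Ci /eqP cr] j].
    have Ci : #|C| = i.
      by rewrite -sum_orbit_content -[RHS]ri; apply: eq_bigr => j _; apply/eqP.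
    rewrite Ci; split=> //; apply/eqP/ffunP => j; apply: ord_inj.
    by rewrite cE //; apply/eqP.
  by rewrite -cE // cr.
rewrite inE => /andP[CP /forallP Cr].
have Ci : #|C| = i.
  by rewrite -sum_orbit_content -[RHS]ri; apply: eq_bigr => j _; apply/eqP.
have pE : \prod_(x in C) p (letter x 0%N) = \prod_(j < a) p j ^+ r j.
  rewrite (partition_big (fun x : word a T => letter x 0%N) xpredT) //=.
  apply: eq_bigr => j _; rewrite -(eqP (Cr j)) /orbit_content.
  rewrite (eq_bigr (fun _ => p j)) => [|x /andP[_ /eqP <-] //].
  rewrite prodr_const; congr (_ ^+ _).
  rewrite -sum1_card big_mkcondr /=; apply: eq_bigr => x _.
  by case: eqP.
by rewrite div1r -pE -Ci.
Qed.

Lemma cycle_index_truncated (R : numFieldType) a K (p : 'I_a -> R) : (0 < a)%N ->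
  vanish K.+1
    (\sum_(0 <= n < K.+1) ser_u R ^+ n *
         riffle_expect p (fun s : 'S_n =>
           \prod_(1 <= i < n.+1) ser_x R i ^+ ncycles i s) -
     \prod_(1 <= i < K.+1)
         \prod_(r : {ffun 'I_a -> 'I_i.+1} | (\sum_(j < a) r j)%N == i)
           (1 / (1 - (\prod_(j < a) p j ^+ r j) *: (ser_u R ^+ i * ser_x R i)))
             ^+ Num.truncn (necklaceM (fun j => r j))).
Proof.
(* The word length [T.+1] is [K!], a multiple of every period up to [K]. *)
move=> a_gt0; pose T := (K`!).-1.
have K_dvd i : (0 < i <= K)%N -> (i %| T.+1)%N.
  by move=> iK; rewrite /T prednK ?fact_gt0 //; apply: dvdn_fact.
rewrite (necklace_factors p K_dvd) big_nat.
under eq_bigr => n nK do rewrite (riffle_expect_cycles p a_gt0 (nK : (n <= K)%N) K_dvd).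
rewrite -big_nat (exchange_big_dep [in pffun_on (@ord0 K) [in porbits (@rho a T)] predT]) /=;
  last by move=> n m _ /andP[].
pose G (m : {ffun {set word a T} -> 'I_K.+1}) := \prod_(C in porbits (@rho a T)) word_weight p C ^+ m C.
(* Intermediate term: truncated geometric series over all orbits. Expanded, its multiplicity
   functions of total weight at most [K] give the left side exactly, and the others vanish to order
   [K + 1]. *)
apply: (@vanish_trans _ _ _ (\prod_(C in porbits (@rho a T)) \sum_(k < K.+1) word_weight p C ^+ k)).
  rewrite (big_distr_big (@ord0 K)) /= -sumrB; apply: vanish_sum => m mP.
  rewrite -/(G m) big_mkord; have [mK|Km] := ltnP (pweight m) K.+1.
    rewrite (big_pred1 (Ordinal mK)) ?subrr // => i.
    by rewrite mP /= eq_sym.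
  rewrite big1 ?sub0r => [|i /andP[_ /eqP mi]]; last first.
    by move: Km; rewrite mi leqNgt ltn_ord.
  apply/vanishN/(vanish_le Km)/vanish_prod => C CP.
  exact/vanishX/vanish_word_weight.
rewrite [X in _ - X]big_mkcondr; apply: vanishB_prod => C CP.
have wC := @vanish_word_weight R a T p C.
have C1 : vanish 1 (word_weight p C).
  apply: vanish_le wC.
  exact: card_porbits_gt0 CP.
have geo := geometric (K := K.+1) C1.
case: leqP => CK; first by rewrite -opprB; apply: vanishN.
(* An orbit with more than [K] elements contributes 1 to the product; its geometric series is also 1
   up to order [K + 1]. *)
rewrite -opprB; apply: vanishN; apply: vanish_trans geo.
rewrite -opprB; apply/vanishN/inv_subr1 => //.
exact: vanish_le wC.
Qed.

Theorem theorem3 (R : realType) (a : nat) (p : 'I_a -> R)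
    (a_gt0 : (0 < a)%N)
    (p_ge0 : forall j, 0 <= p j)
    (p_sum1 : \sum_(j < a) p j = 1) :
  (forall r : 'I_a -> nat, (0 < \sum_(j < a) r j)%N ->
     necklaceM r \is a Num.nat) /\
  exists F : mfps R nat,
    mfps_cvg
      (fun N => \sum_(0 <= n < N) ser_u R ^+ n *
         riffle_expect p (fun s : 'S_n =>
           \prod_(1 <= i < n.+1) ser_x R i ^+ ncycles i s)) F /\
    mfps_cvg
      (fun N => \prod_(1 <= i < N.+1)
         \prod_(r : {ffun 'I_a -> 'I_i.+1} | (\sum_(j < a) r j)%N == i)
           (1 / (1 - (\prod_(j < a) p j ^+ r j) *: (ser_u R ^+ i * ser_x R i)))
             ^+ Num.truncn (necklaceM (fun j => r j))) F.
Proof.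
split=> [r r_gt0|].
  (* Words of length exactly the sum of [r] suffice for counting. Integrality of [necklaceM r] makes
     [Num.truncn] exact in the exponents. *)
  have rT : (\sum_j r j %| (\sum_j r j).-1.+1)%N by rewrite prednK.
  by rewrite (necklaceM_card r_gt0 rT) natr_nat.
(* The sum up to [N.+1] excluded has the terms [n <= N], matching the product over [i <= N]; its
   last term carries the factor [u ^+ N]. *)
apply: vanish_cvg => N; last exact: cycle_index_truncated.
rewrite big_nat_recr //= addrAC subrr add0r; apply: vanishMr.
by rewrite -[X in vanish X]muln1; exact/vanishX/vanish_u.
Qed.
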